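(* A class $\mathcal{D}$ of digraphs has bounded directed treewidth if and only if it has bounded cyclewidth.
   Context: Digraphs are finite without multiple arcs. An arborescence is a directed tree with root $r_0$ and all arcs directed away from $r_0$; for an arc $e$ of $T$ with head $r$, write $t>e$ if $t=r$ or $t$ is reachable from $r$ with $t\ne r$. For $Z\subseteq V(D)$, a set $S\subseteq V(D)\setminus Z$ is $Z$-normal if there is no directed walk in $D-Z$ whose first and last vertices are in $S$ and which uses a vertex of $D-(Z\cup S)$. A directed tree decomposition of $D$ is a triple $(T,\beta,\gamma)$ with $T$ an arborescence, $\beta\colon V(T)\to 2^{V(D)}$, $\gamma\colon E(T)\to 2^{V(D)}$, such that $\{\beta(t)\}$ is a partition of $V(D)$ into possibly empty sets and for every $e\in E(T)$ the set $\bigcup\{\beta(t): t>e\}$ is $\gamma(e)$-normal. With $\Gamma(t)=\beta(t)\cup\bigcup\{\gamma(e): e \text{ incident with } t\}$, the width is $\max_t|\Gamma(t)|-1$; the directed treewidth $\mathrm{dtw}(D)$ is the minimum width. For $X\subseteq V(D)$, $\partial(X)$ is the set of arcs with exactly one endpoint in $X$. A cycle decomposition of $D$ is a pair $(T,\varphi)$ with $T$ a cubic tree (all non-leaf vertices of degree $3$) and $\varphi$ a bijection from the leaves of $T$ to $V(D)$. For an edge $e$ of $T$, with $T_1$ one of the components of $T-e$, let $\partial(e)=\partial(\varphi(\text{leaves of }T_1))$. The cycle porosity of $\partial(e)$ is the maximum, over all families $\mathcal{C}$ of pairwise vertex-disjoint directed cycles of $D$, of $|\partial(e)\cap\bigcup_{C\in\mathcal{C}}E(C)|$.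 The width of $(T,\varphi)$ is the maximum cycle porosity over edges of $T$, and the cyclewidth $\mathrm{cycw}(D)$ is the minimum width of a cycle decomposition of $D$. *)

(* Defs.v *)
From mathcomp Require Import all_boot.
From mathcomp Require Import boolp.
From mathcomp Require Import zify.

Set Implicit Arguments.
Unset Strict Implicit.
Unset Printing Implicit Defensive.

(* Loops are not excluded.  They never lie in a cut and never affect normality,
   so they change neither of the two width parameters. *)
Record digraph := Digraph { vertex :> finType; arc : rel vertex }.

(* Acyclicity asks for length at least 3 because [ucycle] also accepts the
   closed walk x, y, x along a single edge. *)
Definition acyclic (T : finType) (adj : rel T) : Prop :=
  forall c : seq T, ucycle adj c -> size c < 3.

(* The null graph counts as a tree; as a consequence the null digraph has a
   cycle decomposition, and for any other digraph it makes no difference. *)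
Definition is_tree (T : finType) (adj : rel T) : Prop :=
  [/\ symmetric adj, irreflexive adj,
      (forall x y, connect adj x y) & acyclic adj].

(** * Directed treewidth *)

Definition underlying (D : digraph) : rel D := [rel u v | arc u v || arc v u].

(* For an arc (u, v) of an oriented tree: the tree path from r to u avoids v. *)
Definition points_away (D : digraph) (r u v : D) : Prop :=
  exists p : seq D, [/\ path (@underlying D) r p, uniq (r :: p),
                        last r p = u & v \notin r :: p].

Record arborescence := Arborescence {
  arb_digraph :> digraph;
  root : arb_digraph;
  arb_is_tree : is_tree (@underlying arb_digraph);
  arb_oriented : forall u v : arb_digraph, arc u v -> ~~ arc v u;
  arb_away : forall u v : arb_digraph, arc u v -> points_away root u v }.

(* t > e; [connect] is reflexive, so t may be the head of e. *)
Definition below (T : arborescence) (e : T * T) (t : T) : bool :=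
  connect (@arc T) e.2 t.

Definition normal (D : digraph) (Z S : {set D}) : Prop :=
  [disjoint S & Z] /\
  ~ exists x : D, exists p : seq D,
      [/\ path (@arc D) x p, {in x :: p, forall y, y \notin Z},
          x \in S, last x p \in S &
          exists2 y, y \in x :: p & y \notin Z :|: S].

(* [dtd_gamma] is only relevant on pairs that are arcs of the arborescence. *)
Record dtree_decomposition (D : digraph) := DtreeDecomposition {
  dtd_tree : arborescence;
  dtd_beta : dtd_tree -> {set D};
  dtd_gamma : dtd_tree * dtd_tree -> {set D};
  dtd_disjoint : forall s t, s != t -> [disjoint dtd_beta s & dtd_beta t];
  dtd_cover : \bigcup_t dtd_beta t = [set: D];
  dtd_normal : forall e, arc e.1 e.2 ->
    normal (dtd_gamma e) (\bigcup_(t | below e t) dtd_beta t) }.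

Definition dtd_Gamma (D : digraph) (d : dtree_decomposition D)
    (t : dtd_tree d) : {set D} :=
  dtd_beta t :|:
  \bigcup_(e | arc e.1 e.2 && ((e.1 == t) || (e.2 == t))) dtd_gamma e.

(* The predecessor is truncated at 0, which only matters for the null digraph:
   otherwise some bag is nonempty. *)
Definition dtd_width (D : digraph) (d : dtree_decomposition D) : nat :=
  (\max_(t : dtd_tree d) #|dtd_Gamma t|).-1.

Lemma dtd_exists (D : digraph) : inhabited (dtree_decomposition D).
Proof.
pose U := @Digraph unit (fun _ _ => false).
have tU : is_tree (@underlying U).
  split=> //; first by case; case; apply: connect0.
  by move=> [|x [|y [|z c]]].
pose A := @Arborescence U tt tU
  (fun u v (h : false) => False_ind _ (notF h))
  (fun u v (h : false) => False_ind _ (notF h)).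
constructor.
apply: (@DtreeDecomposition D A (fun _ => setT) (fun _ => set0)) => //.
by apply/setP=> x; rewrite in_setT; apply/bigcupP; exists tt.
Qed.

Lemma dtw_subproof (D : digraph) :
  exists n, `[< exists d : dtree_decomposition D, dtd_width d = n >].
Proof. by have [d] := dtd_exists D; exists (dtd_width d); apply/asboolP; exists d. Qed.

Definition dtw (D : digraph) : nat := ex_minn (dtw_subproof D).

(** * Cyclewidth *)

Definition cut (D : digraph) (X : {set D}) : {set D * D} :=
  [set a | arc a.1 a.2 && ((a.1 \in X) (+) (a.2 \in X))].

(* A directed cycle is represented by its set of arcs. *)
Definition is_dicycle (D : digraph) (A : {set D * D}) : Prop :=
  exists c : seq D, [/\ c != [::], ucycle (@arc D) c &
                        A = [set (x, next c x) | x in c]].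

Definition arc_tails (D : digraph) (A : {set D * D}) : {set D} :=
  [set a.1 | a in A].

(* The vertex set of a directed cycle is its set of arc tails. *)
Definition disjoint_dicycles (D : digraph) (F : {set {set D * D}}) : Prop :=
  {in F, forall A, is_dicycle A} /\
  {in F &, forall A B, A != B -> [disjoint arc_tails A & arc_tails B]}.

Definition porosity (D : digraph) (K : {set D * D}) : nat :=
  \max_(F : {set {set D * D}} | `[< disjoint_dicycles F >]) #|K :&: cover F|.

(* Degree 0 only occurs in the one-vertex tree, whose vertex is a leaf. *)
Definition is_leaf (T : finType) (adj : rel T) : pred T :=
  fun t => #|adj t| <= 1.

Definition is_cubic_tree (T : finType) (adj : rel T) : Prop :=
  is_tree adj /\ forall t, ~~ is_leaf adj t -> #|adj t| = 3.

Record cycle_decomposition (D : digraph) := CycleDecomposition {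
  cd_node : finType;
  cd_adj : rel cd_node;
  cd_phi : {t : cd_node | is_leaf cd_adj t} -> D;
  cd_cubic : is_cubic_tree cd_adj;
  cd_bij : bijective cd_phi }.

(* The component of T - e containing e.1; exchanging the ends of e
   complements the set below and so does not change its cut. *)
Definition cd_component (D : digraph) (d : cycle_decomposition D)
    (e : cd_node d * cd_node d) : {set cd_node d} :=
  [set t | connect [rel x y | cd_adj x y && ([set x; y] != [set e.1; e.2])]
                   e.1 t].

Definition cd_cut (D : digraph) (d : cycle_decomposition D)
    (e : cd_node d * cd_node d) : {set D * D} :=
  cut [set cd_phi l | l : {t | is_leaf (@cd_adj D d) t}
                        & val l \in cd_component e].

Definition cd_width (D : digraph) (d : cycle_decomposition D) : nat :=
  \max_(e : cd_node d * cd_node d | cd_adj e.1 e.2) porosity (cd_cut e).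

Lemma cd_of_cubic_tree (D : digraph) (T : finType) (adj : rel T) :
  is_cubic_tree adj -> #|is_leaf adj| = #|D| -> inhabited (cycle_decomposition D).
Proof.
move=> cT cardT.
have cardL : #|{: {t : T | is_leaf adj t}}| = #|D| by rewrite card_sig -cardT.
constructor; apply: (@CycleDecomposition D T adj
  (fun l => enum_val (cast_ord cardL (enum_rank l))) cT).
exists (fun v => enum_val (cast_ord (esym cardL) (enum_rank v))) => x.
- by rewrite enum_valK cast_ordK enum_rankK.
- by rewrite enum_valK cast_ordKV enum_rankK.
Qed.

(* The caterpillar on 0, ..., 2 n + 1: the spine is 0, 1, 3, 5, ..., and each
   of the nodes 2, 4, ... hangs off its predecessor. *)
Definition cat_parent (i : nat) : nat := (i./2.*2).-1.

Definition cat_adj (n : nat) : rel 'I_(n.+1).*2 :=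
  fun i j => (i != j) && ((cat_parent i == j) || (cat_parent j == i)).

Lemma cat_tree (n : nat) : is_tree (@cat_adj n).
Proof.
have symA : symmetric (@cat_adj n).
  by move=> i j; rewrite /cat_adj eq_sym orbC.
split=> //; first by move=> i; rewrite /cat_adj eqxx.
- have c0 (i : 'I_(n.+1).*2) : connect (@cat_adj n) ord0 i.
    have [m] := ubnP (val i); elim: m i => // m IH i lt_im.
    have [->|i_neq0] := eqVneq i ord0; first exact: connect0.
    have i_gt0 : 0 < i by rewrite lt0n; apply: contra i_neq0 => /eqP i0; apply/eqP/val_inj.
    have lt_pi : cat_parent i < i by rewrite /cat_parent; lia.
    pose p := Ordinal (ltn_trans lt_pi (ltn_ord i)).
    apply: (connect_trans (IH p _)); first exact: leq_trans lt_pi lt_im.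
    apply: connect1; rewrite /cat_adj /= eqxx orbT andbT.
    by rewrite -val_eqE /= neq_ltn lt_pi.
  move=> i j; apply: (connect_trans _ (c0 j)).
  by rewrite (sym_connect_sym symA).
- move=> c /andP[cyc uc]; rewrite ltnNge; apply/negP=> c3.
  have [x0 x0c] : exists x, x \in c by case: (c) c3 => // x s _; exists x; rewrite mem_head.
  case: (arg_maxnP (fun x : 'I_(n.+1).*2 => val x) x0c) => m mc m_max.
  have [i s def_s] := rot_to mc.
  have := cyc; rewrite -(rot_cycle i) def_s.
  have := uc; rewrite -(rot_uniq i) def_s.
  have : size (rot i c) = size c by rewrite size_rot.
  rewrite def_s => sz.
  have in_c y : y \in m :: s -> y \in c by rewrite -def_s mem_rot.
  case: s {def_s} sz in_c => [|a s] /=; first by move=> sz; rewrite -sz in c3.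
  case/lastP: s => [|s b] /=; first by move=> sz; rewrite -sz in c3.
  move=> _ in_c /and3P[_ a_notin _]; rewrite rcons_path last_rcons => /and3P[adj_a _ adj_b].
  have /m_max le_a : a \in c by apply: in_c; rewrite !inE eqxx orbT.
  have /m_max le_b : b \in c by apply: in_c; rewrite !inE mem_rcons mem_head !orbT.
  move: a_notin; rewrite mem_rcons inE negb_or => /andP[/eqP neq_ab _].
  apply: neq_ab; apply: val_inj; move: adj_a adj_b le_a le_b.
  by rewrite /cat_adj -!val_eqE /cat_parent /=; lia.
Qed.

Lemma cat_leaf (n : nat) (i : 'I_(n.+1).*2) :
  #|@cat_adj n i| = if ~~ odd i || (i == n.*2.+1 :> nat) then 1 else 3.
Proof.
have in_adj j : (j \in @cat_adj n i) = @cat_adj n i j by [].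
have lt_i := ltn_ord i.
case: ifPn => [leaf_i | inner_i].
  have lt_p : (if i == 0 :> nat then 1 else cat_parent i) < (n.+1).*2.
    by rewrite /cat_parent; case: eqP => _; lia.
  rewrite -(card1 (Ordinal lt_p)); apply: eq_card => j; rewrite in_adj !inE.
  rewrite /cat_adj -!val_eqE /= /cat_parent; have := ltn_ord j.
  by case: (nat_of_ord i =P 0) => i0; lia.
have lt_0 : cat_parent i < (n.+1).*2 by rewrite /cat_parent; lia.
have lt_1 : i.+1 < (n.+1).*2 by lia.
have lt_2 : i.+2 < (n.+1).*2 by lia.
pose s := [:: Ordinal lt_0; Ordinal lt_1; Ordinal lt_2].
have us : uniq s by rewrite /= !inE -!val_eqE /= /cat_parent; lia.
rewrite -[RHS]/(size s) -(card_uniqP us).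
apply: eq_card => j; rewrite in_adj !inE /cat_adj -!val_eqE /= /cat_parent.
by have := ltn_ord j; lia.
Qed.

Lemma cat_cubic (n : nat) : is_cubic_tree (@cat_adj n).
Proof.
by split=> [|i]; [exact: cat_tree | rewrite /is_leaf cat_leaf; case: ifP].
Qed.

Lemma card_cat_leaf (n : nat) : #|is_leaf (@cat_adj n)| = n.+2.
Proof.
have lt_f (k : 'I_n.+2) : minn k.*2 n.*2.+1 < (n.+1).*2 by lia.
have f_inj : injective (fun k => Ordinal (lt_f k)).
  by move=> j k [] eq_jk; apply: val_inj => /=; have := ltn_ord j; have := ltn_ord k; lia.
rewrite -[RHS]card_ord -(card_codom f_inj); apply: eq_card => i.
have -> : (i \in is_leaf (@cat_adj n)) = (~~ odd i || (i == n.*2.+1 :> nat)).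
  by rewrite /in_mem /= /is_leaf cat_leaf; case: ifP.
apply/idP/codomP => [leaf_i | [k ->]] /=; last by have := ltn_ord k; lia.
have lt_i := ltn_ord i; have lt_k : i.+1./2 < n.+2 by lia.
by exists (Ordinal lt_k); apply: val_inj => /=; lia.
Qed.

Lemma cd_exists (D : digraph) : inhabited (cycle_decomposition D).
Proof.
case cardD : #|D| => [|[|n]].
- apply: (@cd_of_cubic_tree D void (fun _ _ => false)); last first.
    by rewrite cardD; apply: eq_card0; case.
  split; last by case.
  by split; [case | case | case | case=> [|[]]].
- apply: (@cd_of_cubic_tree D unit (fun _ _ => false)); last first.
    by rewrite cardD -card_unit; apply: eq_card => t; rewrite /in_mem /= /is_leaf eq_card0.
  split=> [|t]; last by rewrite /is_leaf eq_card0.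
  split=> //; first by case; case; apply: connect0.
  by move=> [|x [|y [|z c]]].
- by apply: (cd_of_cubic_tree (@cat_cubic n)); rewrite card_cat_leaf.
Qed.

Lemma cycw_subproof (D : digraph) :
  exists n, `[< exists d : cycle_decomposition D, cd_width d = n >].
Proof. by have [d] := cd_exists D; exists (cd_width d); apply/asboolP; exists d. Qed.

Definition cycw (D : digraph) : nat := ex_minn (cycw_subproof D).

Definition bounded_on (C : digraph -> Prop) (f : digraph -> nat) : Prop :=
  exists k, forall D, C D -> f D <= k.

(* Main.v *)
Require Import Defs.
From mathcomp Require Import all_boot all_order all_algebra fingroup perm.
From mathcomp Require Import boolp zify.
Import Defs.

Set Implicit Arguments.
Unset Strict Implicit.
Unset Printing Implicit Defensive.

(* Both parameters are compared with balanced separators: for every vertex set W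
   there is a set Z of at most w vertices such that each strong component of
   D - Z contains at most half of W.

   A bag together with its guards, for a lowest node of the arborescence having
   more than half of W below it, is such a separator. In a cubic tree one takes
   a node none of whose branches contains more than half of W, and for each of
   its at most three cuts a set of at most k vertices meeting all cycles across
   the cut. Such a set exists as soon as the porosity of the cut is at most k:
   families of disjoint cycles are permutations moving vertices along arcs, so
   the porosity is the value of an assignment problem, and in an
   optimal dual solution all but at most k vertices have total price 0.

   Conversely, separators are used to split a strong component of D - g, where
   |g| <= 2 (w + 1), by a separator Z of g: a new component is a strong component
   of D - g' with g' made of Z, one more vertex and at most half of g. Splitting
   off the new components one by one in topological order gives a binary
   recursion which is a directed tree decomposition, and also a cycle
   decomposition since a cut around a g-normal set has porosity at most 6 |g|. *)

(** * Assignment duality *)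

Section Potential.
Import Order.TTheory GRing.Theory Num.Theory.
Local Open Scope ring_scope.
Variables (T : finType) (e : rel T) (h : T -> T -> int).

Fixpoint weight (x : T) (p : seq T) : int :=
  if p is y :: q then h x y + weight y q else 0.

Lemma weight_cat x p q : weight x (p ++ q) = weight x p + weight (last x p) q.
Proof. by elim: p x => [|y p IH] x /=; rewrite ?add0r // IH addrA. Qed.

Lemma weight_nth x0 x p :
  weight x p = \sum_(i < size p) h (nth x0 (x :: p) i) (nth x0 p i).
Proof.
elim: p x => [|y p IH] x /=; first by rewrite big_ord0.
by rewrite big_ord_recl /= IH.
Qed.

Lemma weight_cycle x p : uniq (x :: p) ->
  weight x (rcons p x) = \sum_(y in x :: p) h y (next (x :: p) y).
Proof.
move=> Up; rewrite (weight_nth x) size_rcons -(big_uniq _ Up) /= (big_nth x) big_mkord.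
apply: eq_bigr => i _; have lt_i : (i < size (x :: p))%N by [].
rewrite -rcons_cons nth_rcons lt_i.
congr (h _ _); rewrite -[RHS]/(next (x :: p) _) next_nth mem_nth // index_uniq // nth_rcons.
case: ltngtP => // [lt_pi|->]; last by rewrite nth_default.
by rewrite nth_default // ltnW.
Qed.

(* The potential of x is the largest weight of a simple path starting at x. *)
Lemma potential_exists :
    (forall x p, path e x p -> uniq (x :: p) -> e (last x p) x ->
       weight x (rcons p x) <= 0) ->
  exists pi : T -> int, forall x y, e x y -> h x y + pi y <= pi x.
Proof.
move=> no_pos.
have /choice[pi piP] : forall x, exists m,
    (exists p, [/\ path e x p, uniq (x :: p) & m = weight x p]) /\
    (forall p, path e x p -> uniq (x :: p) -> weight x p <= m).
  move=> x.
  (* A simple path has at most [#|T|] vertices, so bounded sequences give a finite type to maximise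
     over. *)
  pose P (p : #|T|.-bseq T) := path e x p && uniq (x :: p).
  have P0 : P [bseq] by [].
  have [m /andP[m1 m2] m_max] :=
    @Order.TotalTheory.arg_maxP _ int _ [bseq] P (fun p => weight x p) P0.
  exists (weight x m); split=> [|p p1 p2]; first by exists m.
  have sz : (size p <= #|T|)%N.
    by case/andP: p2 => _ /card_uniqP <-; apply: max_card.
  by apply: (m_max (Bseq sz)); rewrite /P p1 p2.
exists pi => x y exy; have [[p [p1 p2 ->]] _] := piP y.
have [_ x_max] := piP x.
(* If the optimal path from [y] passes through [x], its part up to [x] closes with the arc from [x]
   to [y] into a cycle of weight at most 0. Dropping this cycle leaves a simple path from [x] that
   is at least as heavy. *)
have [xp|xNp] := boolP (x \in y :: p); last by apply: (x_max (y :: p)); rewrite /= ?exy ?xNp.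
case/splitPl: xp p1 p2 => p1 p2 last_p1; rewrite cat_path -cat_cons cat_uniq last_p1.
case/andP=> e1 e2 /and3P[u1 dis u2].
have := no_pos _ _ e1 u1; rewrite last_p1 -cats1 !weight_cat /= last_p1 addr0 => /(_ exy) le0.
rewrite addrA; apply: (@le_trans _ _ (weight x p2)).
  by rewrite -[leRHS]add0r lerD2r addrC.
apply: x_max => //=; rewrite u2 andbT.
by apply: contra dis => xp2; apply/hasP; exists x; rewrite // -last_p1 mem_last.
Qed.

End Potential.

Section Assignment.
Import Order.TTheory GRing.Theory Num.Theory.
Local Open Scope ring_scope.
Variables (T : finType) (a : rel T) (c : T -> T -> int).

(* Egervary's theorem for the assignments of T to itself along a: the residual
   graph of a maximum-weight assignment s has no cycle of positive weight. *)
Lemma assignment_duality : reflexive a ->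
  exists s : {perm T}, exists pi rho : T -> int,
    [/\ forall x, a x (s x),
        forall x y, a x y -> c x y <= pi x + rho y &
        \sum_x (pi x + rho x) = \sum_x c x (s x)].
Proof.
move=> a_refl; pose P (s : {perm T}) := [forall x, a x (s x)].
have P1 : P 1%g by apply/forallP=> x; rewrite perm1.
have [s /forallP as_s s_max] :=
  @Order.TotalTheory.arg_maxP _ int _ 1%g P (fun s => \sum_x c x (s x)) P1.
(* An edge of [e] from [x] to [y] lets [x] take over the image of [y]; around a cycle the values of
   [h] add up to the change of the total weight. *)
pose e := [rel x y | a x (s y)]; pose h x y := c x (s y) - c y (s y).
have [|pi piP] := @potential_exists T e h.
  move=> x p e_p Up e_last; pose cy := x :: p.
  pose n := perm (can_inj (prev_next Up)).
  have cyc : path.cycle e cy by rewrite /= rcons_path e_p.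
  have n_out y : y \notin cy -> n y = y by rewrite permE next_nth => /negPf ->.
  have : P (n * s)%g.
    apply/forallP=> y; rewrite permM.
    have [y_cy|/n_out-> //] := boolP (y \in cy).
    by rewrite permE; apply: (next_cycle cyc).
  have reind : \sum_y c y (s y) = \sum_y c (n y) (s (n y)).
    by rewrite (reindex_inj (@perm_inj _ n)).
  move=> /s_max le_s; have : \sum_y c y ((n * s)%g y) <= \sum_y c y (s y) by exact: le_s.
  rewrite reind -subr_le0 -sumrB weight_cycle // [X in _ -> X <= 0]big_mkcond.
  congr (_ <= 0); apply: eq_bigr => y _; rewrite permM.
  have [y_cy|y_out] := boolP (y \in cy); last by rewrite n_out // subrr.
  by rewrite !permE.
(* [rho] is chosen to make the dual constraints tight along [s]; the other constraints are the
   inequalities for [pi]. *)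
exists s; exists pi; exists (fun y => c (s^-1%g y) y - pi (s^-1%g y)); split=> // [x y axy|].
  have := piP x (s^-1%g y); rewrite /= /h permKV => /(_ axy); lia.
rewrite big_split /= [X in _ + X](reindex_inj (@perm_inj _ s)) -big_split /=.
by apply: eq_bigr => x _; rewrite permK addrC subrK.
Qed.

End Assignment.

(** * Disjoint cycles as permutations *)

Section CyclePacking.
Variable D : digraph.

(** A fixed point is a vertex off the cycles, or one used by a loop, which no cut contains. *)
Definition cycle_packing (s : {perm D}) : Prop :=
  forall x, s x != x -> arc x (s x).

(** In [cover F] every vertex is the tail of at most one arc and the head of at most one, and tails
    and heads are the same vertices. Following these arcs and fixing all other vertices is therefore
    injective. *)
Lemma packing_of_dicycles (F : {set {set D * D}}) : disjoint_dicycles F ->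
  exists2 s, cycle_packing s & forall a, a \in cover F -> a.2 = s a.1.
Proof.
move=> [F_cyc F_dis].
have same A B a b : A \in F -> B \in F -> a \in A -> b \in B -> a.1 = b.1 -> A = B.
  move=> AF BF aA bB eq_ab; apply/eqP; apply: contraT => /(F_dis _ _ AF BF) dis.
  have := disjointFr dis (imset_f fst aA); rewrite eq_ab.
  by rewrite (imset_f fst bB).
have head_tail A a : A \in F -> a \in A -> exists2 b, b \in A & b.1 = a.2.
  move=> /F_cyc[c [_ _ ->]] /imsetP[x xc ->] /=.
  exists (next c x, next c (next c x)) => //.
  by apply: (imset_f (fun x => (x, next c x))); rewrite mem_next.
have functional A a b : A \in F -> a \in A -> b \in A -> a.1 = b.1 -> a = b.
  by move=> /F_cyc[c [_ _ ->]] /imsetP[x _ ->] /imsetP[y _ ->] /= ->.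
have cofunctional A a b : A \in F -> a \in A -> b \in A -> a.2 = b.2 -> a = b.
  move=> /F_cyc[c [_ /andP[_ Uc] ->]] /imsetP[x _ ->] /imsetP[y _ ->] /=.
  by move/(can_inj (prev_next Uc)) ->.
pose t x := if [pick a in cover F | a.1 == x] is Some a then a.2 else x.
have tE a : a \in cover F -> t a.1 = a.2.
  rewrite /t => aF; case: pickP => [b /andP[bF /eqP eq_ab]|/(_ a)]; last by rewrite aF eqxx.
  have [/bigcupP[A AF aA] /bigcupP[B BF bB]] := (aF, bF).
  have BA : B = A by apply: (same _ _ b a).
  by rewrite (functional A b a) // -BA.
have t_out x : t x = x \/ exists2 a, a \in cover F & a.1 = x.
  by rewrite /t; case: pickP => [a /andP[aF /eqP <-]|]; [right; exists a | left].
have t_inj : injective t.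
  have out x a : a \in cover F -> t x = a.2 -> exists2 b, b \in cover F & b.1 = x.
    move=> aF; have [-> x_a|//] := t_out x.
    have /bigcupP[A AF aA] := aF; have [b bA b_a] := head_tail A a AF aA.
    by exists b; [apply/bigcupP; exists A | rewrite b_a].
  have cofun a b : a \in cover F -> b \in cover F -> a.2 = b.2 -> a = b.
    move=> /bigcupP[A AF aA] /bigcupP[B BF bB] eq_ab.
    have [a' a'A a'E] := head_tail A a AF aA; have [b' b'B b'E] := head_tail B b BF bB.
    have AB : A = B by apply: (same _ _ a' b') => //; rewrite a'E b'E.
    by apply: (cofunctional A) => //; rewrite AB.
  have inj a y : a \in cover F -> t a.1 = t y -> a.1 = y.
    move=> aF; rewrite tE // => eq_t; have [b bF yb] := out y a aF (esym eq_t).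
    by rewrite -yb (cofun a b) // eq_t -yb tE.
  move=> x y eq_t; have [tx|[a aF ax]] := t_out x; last first.
    by rewrite -ax; apply: inj; rewrite // ax.
  have [ty|[b bF yb]] := t_out y; first by rewrite -tx eq_t.
  by rewrite -yb; apply/esym/inj; rewrite // yb.
exists (perm t_inj) => [x|a aF]; last by rewrite permE tE.
rewrite permE; have [->|[a aF <- _]] := t_out x; first by rewrite eqxx.
rewrite tE //; have /bigcupP[A /F_cyc[c [_ /andP[c_cyc _] ->]]] := aF.
by case/imsetP=> y yc -> /=; apply: next_cycle.
Qed.

(** The cycles are the orbits of the moved points; as [s] is injective, such an orbit contains moved
    points only. *)
Lemma dicycles_of_packing (s : {perm D}) : cycle_packing s ->
  exists2 F, disjoint_dicycles F & forall x, s x != x -> (x, s x) \in cover F.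
Proof.
move=> s_pack; have s_inj := @perm_inj _ s.
pose A x := [set (y, s y) | y in orbit s x].
exists [set A x | x in [pred x | s x != x]]; last first.
  move=> x s_x; apply/bigcupP; exists (A x); first by apply: imset_f; rewrite inE.
  by apply: imset_f; apply: in_orbit.
have tails x : arc_tails (A x) =i orbit s x.
  move=> y; apply/imsetP/idP => [[_ /imsetP[z zx ->] -> //]|yx].
  by exists (y, s y) => //; apply: imset_f.
split=> [_ /imsetP[x s_x ->]|_ _ /imsetP[x s_x ->] /imsetP[y s_y ->]].
  have moved y : y \in orbit s x -> s y != y.
    rewrite -fconnect_orbit => /iter_findex <-; rewrite -iterS iterSr.
    apply: contra s_x; elim: findex => //= n IH /eqP/s_inj/eqP; exact: IH.
  exists (orbit s x); split.
  - by rewrite -size_eq0 size_orbit -lt0n fingraph.order_gt0.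
  - rewrite /ucycle orbit_uniq andbT.
    have: path.cycle (frel s) (orbit s x) by apply: cycle_orbit.
    apply: (sub_in_cycle (P := mem (orbit s x))); last by apply/allP.
    by move=> y z /moved /s_pack + _ /= /eqP <-.
  - apply: eq_in_imset => y yx; congr (_, _).
    by apply/eqP; have := next_cycle (cycle_orbit s_inj x) yx.
apply: contraR => /pred0Pn[z /=]; rewrite !tails -!fconnect_orbit => /andP[xz yz].
have eq_xy : orbit s x =i orbit s y.
  move=> u; rewrite -!fconnect_orbit; apply: (same_connect (fconnect_sym s_inj)).
  by apply: connect_trans xz _; rewrite fconnect_sym.
by apply/eqP/setP=> a; apply/imsetP/imsetP=> -[u uP ->]; exists u; rewrite // ?eq_xy // -eq_xy.
Qed.

End CyclePacking.

(** * Strong components and porosity *)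

Section Separation.
Variable D : digraph.
Implicit Types (Z S W X : {set D}) (x y z u v : D).

Definition arc_off Z : rel D := [rel u v | [&& arc u v, u \notin Z & v \notin Z]].

(** For [x] in [Z] this is the singleton of [x], because [arc_off] isolates the vertices of [Z]. *)
Definition scc Z x : {set D} :=
  [set y | connect (arc_off Z) x y && connect (arc_off Z) y x].

Lemma arc_offS Z Z' : Z \subset Z' -> subrel (arc_off Z') (arc_off Z).
Proof.
move=> /subsetP sZ u v /and3P[uv uZ vZ].
by apply/and3P; split=> //; [apply: contra uZ | apply: contra vZ]; apply: sZ.
Qed.

Lemma connect_offS Z Z' x y : Z \subset Z' ->
  connect (arc_off Z') x y -> connect (arc_off Z) x y.
Proof. by move=> sZ; apply: connect_sub => u v /(arc_offS sZ); apply: connect1. Qed.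

Lemma connect_off_notin Z x y : x \notin Z -> connect (arc_off Z) x y -> y \notin Z.
Proof.
move=> xZ /connectP[p + ->]; elim: p x xZ => //= y' p IH x xZ /andP[/and3P[_ _ yZ]].
exact: IH.
Qed.

Lemma in_scc Z x : x \in scc Z x.
Proof. by rewrite inE connect0. Qed.

Lemma scc_eq Z x y : y \in scc Z x -> scc Z y = scc Z x.
Proof.
rewrite inE => /andP[xy yx]; apply/setP=> z; rewrite !inE.
apply/andP/andP=> -[h1 h2]; split.
- exact: connect_trans xy h1.
- exact: connect_trans h2 yx.
- exact: connect_trans yx h1.
- exact: connect_trans h2 xy.
Qed.

Lemma scc_notin Z x y : x \notin Z -> y \in scc Z x -> y \notin Z.
Proof. by move=> xZ; rewrite inE => /andP[/(connect_off_notin xZ)]. Qed.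

Lemma sccS Z Z' x : Z \subset Z' -> scc Z' x \subset scc Z x.
Proof.
move=> sZ; apply/subsetP=> y; rewrite !inE => /andP[h1 h2].
by rewrite !(connect_offS sZ).
Qed.

(** Cutting a walk at a vertex outside [S] turns normality into convexity for reachability in D - Z,
    the form used from here on. *)
Lemma normalE Z S : normal Z S <->
  [disjoint S & Z] /\
  forall x y z, x \in S -> z \in S -> connect (arc_off Z) x y ->
    connect (arc_off Z) y z -> y \in S.
Proof.
split=> -[dis nrm]; split=> //.
  move=> x y z xS zS /connectP[p xp yE] /connectP[q yq zE]; apply: contraT => yS.
  have off u r : u \notin Z -> path (arc_off Z) u r -> {in u :: r, forall w, w \notin Z}.
    elim: r u => [|v r IH] u uZ /=; first by move=> _ w; rewrite inE => /eqP ->.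
    case/andP=> /and3P[_ _ vZ] /(IH v vZ) all_r w; rewrite inE => /orP[/eqP -> //|].
    exact: all_r.
  have xZ : x \notin Z by rewrite (disjointFr dis).
  have pq : path (arc_off Z) x (p ++ q) by rewrite cat_path xp -yE.
  have all_Z := off _ _ xZ pq.
  case: nrm; exists x, (p ++ q); split=> //.
  - by apply: sub_path pq => u v /and3P[].
  - by rewrite last_cat -yE -zE.
  - have y_in : y \in x :: p ++ q by rewrite -cat_cons mem_cat yE mem_last.
    by exists y => //; rewrite inE negb_or yS all_Z.
move=> [x [p [xp all_Z xS lS [y yp]]]]; rewrite inE negb_or => /andP[yZ /negP[]].
have xpZ : path (arc_off Z) x p.
  elim: p x xp all_Z {xS lS yp} => //= v p IH x /andP[xv vp] all_Z.
  apply/andP; split; first by rewrite /arc_off /= xv !all_Z ?inE ?eqxx ?orbT.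
  apply: IH => // w wp.
  by apply: all_Z; rewrite inE wp orbT.
move: xpZ lS; case/splitPl: yp => p1 p2 last_p1.
rewrite cat_path last_cat last_p1 => /andP[e1 e2] lS.
apply: nrm xS lS _ _; first by apply/connectP; exists p1.
by apply/connectP; exists p2.
Qed.

Lemma scc_normal Z x : x \notin Z -> normal Z (scc Z x).
Proof.
move=> xZ; apply/normalE; split.
  by rewrite disjoint_subset; apply/subsetP=> y /(scc_notin xZ).
move=> u y v; rewrite !inE => /andP[xu _] /andP[_ vx] uy yv.
by rewrite (connect_trans xu uy) (connect_trans yv vx).
Qed.

Lemma porosityP (K : {set D * D}) k :
  porosity K <= k <-> forall F, disjoint_dicycles F -> #|K :&: cover F| <= k.
Proof.
split=> [/bigmax_leqP le_k F F_dis|le_k]; first by apply: le_k; apply/asboolP.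
by apply/bigmax_leqP => F /asboolP /le_k.
Qed.

Lemma cutP X u v : ((u, v) \in cut X) = arc u v && ((u \in X) (+) (v \in X)).
Proof. by rewrite inE. Qed.

Lemma sum_graph (s : D -> D) (K : {set D * D}) :
  \sum_u ((u, s u) \in K) = #|[set a in K | a.2 == s a.1]|.
Proof.
transitivity #|[set u | (u, s u) \in K]|.
  by rewrite -sum1dep_card [RHS]big_mkcond; apply: eq_bigr => u _; case: (_ \in _).
have inj : injective (fun u => (u, s u)) by move=> u v [].
rewrite -(card_imset _ inj); apply: eq_card => -[u v]; rewrite !inE /=.
apply/imsetP/andP => [[w] | [uvK /eqP v_s]]; first by rewrite inE => wK [-> ->].
by exists u; rewrite ?inE -v_s.
Qed.

Section Duality.
Import Order.TTheory GRing.Theory Num.Theory.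
Local Open Scope ring_scope.

(* Vertex-disjoint families of cycles are the permutations moving vertices along
   arcs only, so the porosity is the optimum of an assignment problem. Z consists
   of the vertices u with pi u + rho u <> 0. *)
Lemma separator_of_porosity X k : (porosity (cut X) <= k)%N ->
  exists2 Z : {set D}, (#|Z| <= k)%N &
    forall x y, y \in scc Z x -> (x \in X) = (y \in X).
Proof.
move=> /porosityP por.
pose a : rel D := [rel u v | (u == v) || arc u v].
pose c u v : int := ((u, v) \in cut X : nat)%:Z.
have [u|s [pi [rho [as_s dual opt]]]] := @assignment_duality D a c; first exact/predU1l.
have c_loop u : c u u = 0 by rewrite /c cutP addbb andbF.
have s_pack : cycle_packing s.
  by move=> u; have /orP[/eqP <-|//] := as_s u; rewrite eqxx.
have [F F_dis F_cov] := dicycles_of_packing s_pack.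
have le_k : \sum_u c u (s u) <= k%:Z.
  rewrite /c -(big_morph _ PoszD (erefl _)) lez_nat.
  apply: leq_trans (por F F_dis); rewrite sum_graph.
  apply: subset_leq_card; apply/subsetP => -[u v]; rewrite in_set => /andP[uvK /eqP /= v_s].
  move: uvK; rewrite v_s in_setI => uvK; rewrite uvK F_cov //.
  by apply: contraTneq uvK => ->; rewrite cutP addbb andbF.
(* The loops of [a] have cost 0, and their dual constraints make all total prices nonnegative. *)
have y_ge0 u : 0 <= pi u + rho u by rewrite -(c_loop u) dual //; apply/predU1l.
pose Z := [set u | 0 < pi u + rho u].
have rhoE u : u \notin Z -> rho u = - pi u by have := y_ge0 u; rewrite inE; lia.
(* Outside [Z] the two prices of a vertex cancel, so [pi] never increases along an arc and drops by
   at least 1 across the cut. On a strong component [pi] is then constant, and no arc of a path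
   inside it crosses the cut. *)
have mono u v : arc_off Z u v -> c u v + pi v <= pi u.
  move=> /and3P[uv uZ vZ]; have := dual u v (predU1r _ _ uv); rewrite (rhoE v) //; lia.
have c_ge0 u v : 0 <= c u v by [].
have conn u v : connect (arc_off Z) u v -> pi v <= pi u.
  move=> /connectP[p + ->]; elim: p u => //= w p IH u /andP[/mono uw /IH].
  by have := c_ge0 u w; lia.
exists Z.
  (* Prices are integers, so every vertex of [Z] contributes at least 1 to the optimum. *)
  rewrite -lez_nat; apply: le_trans le_k; rewrite -opt -sum1_card.
  rewrite (big_morph _ PoszD (erefl _)) [leRHS](bigID (mem Z)) /= -[leLHS]addr0.
  apply: lerD; last by apply: sumr_ge0.
  by apply: ler_sum => u; rewrite inE.
move=> x y; rewrite inE => /andP[xy yx].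
have /conn := xy; have /conn := yx.
case/connectP: xy => p + ->; elim: p x {yx} => //= w p IH x /andP[xw wp] le1 le2.
have le3 := mono _ _ xw.
have le4 : pi (last w p) <= pi w by apply: conn; apply/connectP; exists p.
have := c_ge0 x w => c0.
rewrite -(IH w) //; try lia.
have : c x w = 0 by lia.
by rewrite /c cutP; have /and3P[-> _ _] := xw; case: (x \in X); case: (w \in X).
Qed.

End Duality.

(** This is weak duality: summed over a permutation, the terms in [pi] cancel, and [b] is counted
    once at tails and once at heads, whence the factor 2. *)
Lemma porosity_potential X (pi b : D -> nat) :
  (forall u v, arc u v -> (((u \in X) (+) (v \in X)) + pi v <= pi u + b u + b v)%N) ->
  porosity (cut X) <= 2 * \sum_u b u.
Proof.
move=> ineq; apply/porosityP => F /packing_of_dicycles[s s_pack sE].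
have : \sum_u (((u, s u) \in cut X) + pi (s u)) <= \sum_u (pi u + b u + b (s u)).
  apply: leq_sum => u _; rewrite cutP; have [->|/s_pack us] := eqVneq (s u) u.
    by rewrite addbb andbF; lia.
  by rewrite us; apply: ineq.
have reind (f : D -> nat) : \sum_u f (s u) = \sum_u f u.
  by rewrite [RHS](reindex_inj (@perm_inj _ s)).
rewrite !big_split /= !reind sum_graph => le_b.
have : #|cut X :&: cover F| <= #|[set a in cut X | a.2 == s a.1]|.
  apply: subset_leq_card; apply/subsetP => a; rewrite in_setI => /andP[aX /sE aE].
  by rewrite in_set aX aE eqxx.
move: le_b; rewrite addnC -addnA leq_add2l addnn -mul2n => le_b le_c.
exact: leq_trans le_c le_b.
Qed.

End Separation.

(** * Guarded recursive splittings *)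

Section Decomposition.
Variable D : digraph.
Implicit Types (Z S W X : {set D}) (x y z u v : D).

Lemma scc_sub Z S x : normal Z S -> x \in S -> scc Z x \subset S.
Proof.
case/normalE=> _ nrm xS; apply/subsetP=> y; rewrite inE => /andP[xy yx].
exact: (nrm x y x).
Qed.

(** A path of D - Z between vertices of the component stays in the component, hence avoids [Z'] as
    well. *)
Lemma scc_disjoint Z Z' x :
  Z \subset Z' -> [disjoint scc Z x & Z'] -> scc Z' x = scc Z x.
Proof.
move=> sZ dis; apply/eqP; rewrite eqEsubset sccS //=.
have conn u v : u \in scc Z x -> v \in scc Z x ->
    connect (arc_off Z) u v -> connect (arc_off Z') u v.
  move=> + + /connectP[p]; elim: p u => [u _ _ _ -> //|w p IH u ux vx /andP[uw wp] v_last].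
  have wx : w \in scc Z x.
    move: ux vx; rewrite !inE => /andP[xu _] /andP[_ vx].
    rewrite (connect_trans xu (connect1 uw)) (connect_trans _ vx) //.
    by apply/connectP; exists p.
  apply: connect_trans (IH w wx vx wp v_last); apply: connect1.
  have /and3P[arc_uw _ _] := uw.
  by apply/and3P; split; rewrite // (disjointFr dis).
apply/subsetP=> y yx; have := yx; rewrite !inE => /andP[xy yx'].
by rewrite !conn ?in_scc.
Qed.

(** Outside [Z'], the potential is 1 on [S], 2 on the other vertices that reach [S], and 0
    elsewhere. Normality makes it monotone along arcs, with a drop of 1 on entering or leaving [S].
    Arcs at [Z'] are paid for by [b] = 3, which covers a potential of 2 and one crossing; this gives
    6 = 2 * 3. *)
Lemma porosity_normal Z S S' Z' : normal Z S -> Z \subset Z' ->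
  S' :\: Z' = S :\: Z' -> porosity (cut S') <= 6 * #|Z'|.
Proof.
move=> /normalE[dis nrm] sZ /setP eqS.
pose reach u := [exists v in S, connect (arc_off Z) u v].
pose pi u := if u \in Z' then 0 else if u \in S then 1 else if reach u then 2 else 0.
have -> : 6 * #|Z'| = 2 * \sum_u (if u \in Z' then 3 else 0).
  by rewrite -big_mkcond sum_nat_const; lia.
have pi_le2 u : pi u <= 2 by rewrite /pi; do 3![case: ifP => // _].
apply: (porosity_potential (pi := pi)) => u v uv.
have c_le1 := leq_b1 ((u \in S') (+) (v \in S')).
case: (boolP (u \in Z')) => [_|uZ]; first by have := pi_le2 v; lia.
case: (boolP (v \in Z')) => [_|vZ]; first by have := pi_le2 v; lia.
rewrite /pi (negPf uZ) (negPf vZ).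
have := eqS u; have := eqS v; rewrite !inE uZ vZ /= => -> ->.
have off : arc_off Z u v.
  by apply/and3P; split=> //; [apply: contra uZ | apply: contra vZ]; apply: (subsetP sZ).
have [uS|uS] := boolP (u \in S); have [vS|vS] := boolP (v \in S) => //=.
- suff -> : reach v = false by [].
  apply: contraNF vS => /existsP[w /andP[wS vw]].
  exact: (nrm u v w uS wS (connect1 off) vw).
- suff -> : reach u by [].
  by apply/existsP; exists v; rewrite vS connect1.
- have [|//] := boolP (reach v); case/existsP=> w /andP[wS vw].
  suff -> : reach u by [].
  by apply/existsP; exists w; rewrite wS (connect_trans (connect1 off)).
Qed.

(* A common source of directed tree decompositions and cycle decompositions of
   width O(K): S is the part of D below an arc with guard g, and
   S :\: (S1 :|: S2) is the bag. *)
Inductive guarded K : {set D} -> {set D} -> Prop :=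
| guarded0 (g : {set D}) : #|g| <= K -> guarded K g set0
| guardedU (g S g1 S1 g2 S2 Z : {set D}) of
    normal g S & #|Z| <= K &
    [/\ S :\: (S1 :|: S2) \subset Z, g \subset Z, g1 \subset Z & g2 \subset Z] &
    [/\ S1 \subset S, S2 \subset S & [disjoint S1 & S2]] &
    guarded K g1 S1 & guarded K g2 S2 : guarded K g S.

(* The strong components of D - Z in Y are split off one by one, each time a
   component which cannot be reached from the rest of Y. *)
Lemma guarded_closed K Z S Z' (Y : {set D}) : normal Z S -> Z \subset Z' -> #|Z'| <= K ->
    (forall x, x \in S :\: Z' -> exists2 g : {set D}, g \subset Z' & guarded K g (scc Z' x)) ->
    Y \subset S :\: Z' ->
    (forall x y, x \in Y -> y \in S :\: Z' -> connect (arc_off Z') x y -> y \in Y) ->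
  guarded K Z' Y.
Proof.
move=> nrmS sZ leK comp; have /normalE[dis nrm] := nrmS.
have [n] := ubnP #|Y|; elim: n Y => // n IH Y /ltnSE le_n sY closY.
have [->|[x0 x0Y]] := set_0Vmem Y; first exact: guarded0.
(* A vertex with the largest reach lies in a source component: a vertex reaching it reaches at least
   as much, hence exactly the same set, and so is reached back. *)
case: (arg_maxnP (fun x => #|[set y | connect (arc_off Z') x y]|) x0Y) => x xY x_max.
have xSZ := subsetP sY x xY; have [g sg g_x] := comp x xSZ.
have inS u y v : u \in S -> v \in S -> connect (arc_off Z') u y ->
    connect (arc_off Z') y v -> y \in S.
  by move=> uS vS /(connect_offS sZ) uy /(connect_offS sZ); exact: (nrm u y v uS vS uy).
have closed_between u y v : u \in Y -> v \in Y -> connect (arc_off Z') u y ->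
    connect (arc_off Z') y v -> y \in Y.
  move=> uY vY uy yv; have := subsetP sY u uY; have := subsetP sY v vY.
  rewrite !inE => /andP[_ vS] /andP[uZ uS]; apply: (closY u y uY _ uy).
  by rewrite inE (inS u y v) // (connect_off_notin uZ uy).
have sC : scc Z' x \subset Y.
  apply/subsetP=> y; rewrite inE => /andP[xy yx]; exact: (closed_between x y x).
(* The bag is empty: [Y] is the union of the component split off and the rest. *)
apply: (@guardedU _ _ _ g (scc Z' x) Z' (Y :\: scc Z' x) Z') => //.
- apply/normalE; split; last by move=> u y v uY vY; exact: closed_between.
  by rewrite disjoint_subset; apply/subsetP=> y /(subsetP sY); rewrite inE => /andP[].
- split=> //; apply/subsetP=> y; rewrite !inE; case: (y \in Y); rewrite ?andbT ?andbF //.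
  by case: (connect _ x y && _).
- split=> //; first exact: subsetDl.
  by rewrite disjoint_sym disjoints_subset; apply/subsetP=> y; rewrite !inE => /andP[].
apply: IH.
- apply: leq_trans le_n; apply: proper_card; apply/properP; split; first exact: subsetDl.
  by exists x; rewrite // in_setD in_scc.
- exact: subset_trans (subsetDl _ _) sY.
move=> u y; rewrite in_setD => /andP[uC uY] ySZ uy.
rewrite in_setD (closY u) // andbT; apply: contra uC; rewrite !inE => /andP[xy yx].
have ux := connect_trans uy yx; rewrite ux andbT.
have sub : [set z | connect (arc_off Z') x z] \subset [set z | connect (arc_off Z') u z].
  by apply/subsetP=> z; rewrite !inE; apply: connect_trans.
have /setP/(_ u) : [set z | connect (arc_off Z') x z] = [set z | connect (arc_off Z') u z].
  by apply/eqP; rewrite eqEcard sub; apply: x_max.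
by rewrite !inE connect0.
Qed.

Definition balanced_separators w : Prop :=
  forall W, exists2 Z : {set D}, #|Z| <= w &
    forall x, x \notin Z -> #|W :&: scc Z x|.*2 <= #|W|.

Section FromSeparators.
Variable w : nat.
Hypothesis sep : balanced_separators w.

Lemma guarded_scc Z x : x \notin Z -> #|Z| <= (w.+1).*2 -> guarded (3 * w.+1) Z (scc Z x).
Proof.
have [n] := ubnP #|scc Z x|; elim: n Z x => // n IH Z x /ltnSE le_n xZ le_Z.
have [Z1 le_Z1 Z1_bal] := sep Z.
(* Deleting [x] too makes every new component smaller than [scc Z x]. The size is at most 1 + 2(w +
   1) + w = 3(w + 1). *)
pose Z' := x |: (Z :|: Z1).
have sZ : Z \subset Z' by rewrite /Z' setUCA subsetUl.
have le_Z' : #|Z'| <= 3 * w.+1.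
  rewrite /Z'; have := cardsU1 x (Z :|: Z1); have := (leq_card_setU Z Z1).1; lia.
have nrm := scc_normal xZ.
apply: (@guardedU _ _ _ Z' (scc Z x :\: Z') Z' set0 Z') => //.
- split=> //; apply/subsetP=> y; rewrite !inE orbF.
  by case: (connect _ x y && _); rewrite ?andbF // !andbT negbK.
- by split; rewrite ?subsetDl ?sub0set // disjoint_sym -setI_eq0 set0I.
- apply: (guarded_closed nrm) => // y ySZ.
  move: ySZ; rewrite in_setD => /andP[yZ' yx].
  have yZ1 : y \notin Z1 by apply: contra yZ'; rewrite !inE => ->; rewrite !orbT.
  (* The vertices of [Z] left out lie outside [scc Z1 y], so deleting [g] alone gives the same
     component. As [Z1] is balanced for [Z], the size is at most 1 + w + (w + 1) = 2(w + 1). *)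
  pose g := x |: (Z1 :|: (Z :&: scc Z1 y)).
  have sg : g \subset Z'.
    apply/subsetP=> u; rewrite in_setU1 in_setU in_setI /Z' !in_setU in_set1.
    by case/or3P=> [->|->|/andP[-> _]]; rewrite ?orbT.
  have scc_g : scc Z' y = scc g y.
    apply: scc_disjoint => //; rewrite disjoint_subset; apply/subsetP=> u u_y.
    have uNg : u \notin g.
      by apply: scc_notin u_y; apply: contra yZ'; apply: (subsetP sg).
    have uU : u \in scc Z1 y.
      apply: (subsetP (sccS y _)) u_y.
      by apply/subsetP=> z zZ1; rewrite /g !in_setU zZ1 orbT.
    rewrite inE; apply: contra uNg; rewrite /g /Z' !in_setU !in_setI uU andbT.
    by case/or3P=> ->; rewrite ?orbT.
  exists g => //; rewrite scc_g; apply: IH.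
  - apply: leq_trans le_n; rewrite -scc_g; apply: proper_card; apply/properP; split.
      by rewrite -(scc_eq yx) sccS.
    exists x; first exact: in_scc.
    by apply/negP=> /(scc_notin yZ'); rewrite in_setU1 eqxx.
  - by apply: contra yZ'; apply: (subsetP sg).
  - have := Z1_bal y yZ1; rewrite /g; have := cardsU1 x (Z1 :|: (Z :&: scc Z1 y)).
    have := (leq_card_setU Z1 (Z :&: scc Z1 y)).1; lia.
exact: guarded0.
Qed.

Lemma guarded_all : guarded (3 * w.+1) set0 [set: D].
Proof.
have nrm : normal set0 [set: D].
  by apply/normalE; split=> //; rewrite -setI_eq0 setI0.
apply: (guarded_closed nrm) => //; rewrite ?cards0 ?setD0 // => x _.
by exists set0 => //; apply: guarded_scc; rewrite ?inE ?cards0.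
Qed.

End FromSeparators.
End Decomposition.

(** * Trees *)

Section Tree.
Variables (T : finType) (adj : rel T).
Hypothesis treeT : is_tree adj.

Definition delete_edge x y : rel T :=
  [rel u v | adj u v && ([set u; v] != [set x; y])].

(** This unfolds to the set that [cd_component] assigns to the pair (y, x). *)
Definition branch y x : {set T} := [set t | connect (delete_edge y x) y t].

Lemma adj_sym x y : adj x y = adj y x.
Proof. by case: treeT. Qed.

Lemma delete_edge_connect_sym x y : connect_sym (delete_edge x y).
Proof.
by apply: sym_connect_sym => u v; rewrite /delete_edge /= adj_sym [[set u; v]]setUC.
Qed.

Lemma path_delete_edge x y z p : path adj z p -> x \notin z :: p ->
  connect (delete_edge x y) z (last z p).
Proof.
elim: p z => [|w p IH] z /=; first by rewrite connect0.
case/andP=> zw wp; rewrite inE negb_or => /andP[xz xp].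
apply: connect_trans (IH w wp xp); apply: connect1; rewrite /delete_edge /= zw /=.
apply/eqP=> /setP/(_ x); rewrite !inE eqxx (negPf xz) /= => /eqP/eqP xw.
by move: xp; rewrite inE xw.
Qed.

(** A path from [y] to [x] avoiding the edge has at least two steps, so the edge would close it to a
    cycle of length at least 3. *)
Lemma bridge x y : adj x y -> ~~ connect (delete_edge x y) y x.
Proof.
have [_ irr _ acyc] := treeT; move=> xy; apply/negP=> /connectP[p0 /shortenP[p yp Up _] xE].
have adj_p : path adj y p by apply: sub_path yp => u v /andP[].
have /acyc : ucycle adj (y :: p) by rewrite /ucycle Up /= rcons_path adj_p -xE xy.
case: p yp xE {Up adj_p} => [|z [|? ?]] //=; first by move=> _ xE; rewrite xE irr in xy.
by rewrite andbT => /andP[_ +] zE; rewrite -zE setUC eqxx.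
Qed.

Lemma branch_root x y : y \in branch y x.
Proof. by rewrite inE connect0. Qed.

Lemma branch_notin x y : adj x y -> x \notin branch y x.
Proof. by rewrite inE adj_sym => /bridge; rewrite delete_edge_connect_sym. Qed.

Lemma delete_edgeC x y : delete_edge x y =2 delete_edge y x.
Proof. by move=> u v; rewrite /delete_edge /= [[set x; y]]setUC. Qed.

Lemma branch_compl x y : adj x y -> branch x y = ~: branch y x.
Proof.
move=> xy; apply/setP=> t; rewrite in_setC; apply/idP/idP => [tx|].
  apply: contra (bridge xy); rewrite !inE => ty.
  rewrite -(eq_connect (delete_edgeC y x)); apply: connect_trans ty _.
  by rewrite (eq_connect (delete_edgeC y x)) delete_edge_connect_sym; rewrite inE in tx.
have gen z p : connect (delete_edge x y) x z || connect (delete_edge x y) y z ->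
    path adj z p ->
    connect (delete_edge x y) x (last z p) || connect (delete_edge x y) y (last z p).
  elim: p z => //= u p IH z zI /andP[zu up]; apply: IH up.
  have [eq_e|ne_e] := eqVneq [set z; u] [set x; y]; last first.
    have zu' : connect (delete_edge x y) z u by apply: connect1; rewrite /delete_edge /= zu.
    by case/orP: zI => h; rewrite (connect_trans h zu') ?orbT.
  have : u \in [set x; y] by rewrite -eq_e !inE eqxx orbT.
  by rewrite !inE => /orP[/eqP->|/eqP->]; rewrite connect0 ?orbT.
have [_ _ conn _] := treeT; have /connectP[p xp ->] := conn x t.
rewrite !inE (eq_connect (delete_edgeC y x)).
by have := gen x p; rewrite connect0 xp => /(_ isT isT)/orP[-> //|->].
Qed.

Lemma branch_cover x t : t != x -> exists2 y, adj x y & t \in branch y x.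
Proof.
have [_ _ conn _] := treeT => tx; have /connectP[p0 /shortenP[p xp Up _] tE] := conn x t.
case: p xp Up tE => [|y p] /=; first by move=> _ _ tE; rewrite tE eqxx in tx.
case/andP=> xy yp /andP[xNp _] ->; exists y => //.
by rewrite inE (eq_connect (delete_edgeC y x)); apply: path_delete_edge.
Qed.

(** A walk inside [branch z y] never meets [y], so it cannot use the edge between [y] and [x]. *)
Lemma branch_sub x y z : adj y x -> adj y z -> z != x -> branch z y \subset branch y x.
Proof.
move=> yx yz zx; apply/subsetP=> t; rewrite !inE => /connectP[p zp ->].
have step : connect (delete_edge y x) y z.
  apply: connect1; rewrite /delete_edge /= yz; apply/eqP=> /setP/(_ z).
  rewrite !inE eqxx orbT (negPf zx).
  by case: (z =P y) => // zy; have := branch_notin yz; rewrite zy branch_root.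
have gen u q : u \in branch z y -> path (delete_edge z y) u q ->
    connect (delete_edge y x) u (last u q).
  elim: q u => //= v q IH u uB /andP[uv vq].
  have vB : v \in branch z y.
    by move: uB; rewrite !inE => uB; apply: connect_trans uB (connect1 uv).
  apply: connect_trans (IH v vB vq); apply: connect1; case/andP: uv => uv _.
  rewrite /delete_edge /= uv /=; apply/eqP=> /setP/(_ y); rewrite !inE eqxx /=.
  have yB := branch_notin yz.
  by case/orP=> /eqP eq_y; [move: uB | move: vB]; rewrite -eq_y (negPf yB).
by apply: connect_trans step (gen z p _ zp); apply: branch_root.
Qed.

End Tree.

Section Arborescence.
Variable T : arborescence.

Lemma arb_acyclic (t c : T) : arc t c -> ~~ connect (@arc T) c t.
Proof.
have [_ _ _ acyc] := arb_is_tree T; move=> tc; apply/negP=> /connectP[p0 /shortenP[p cp Up _] tE].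
have und : path (@underlying T) c p by apply: sub_path cp => u v uv; rewrite /underlying /= uv.
have /acyc : ucycle (@underlying T) (c :: p).
  by rewrite /ucycle Up /= rcons_path und -tE /underlying /= tc.
case: p cp tE {Up und} => [|z [|? ?]] //=.
  by move=> _ tE; have := arb_oriented tc; rewrite -tE in tc *; rewrite tc.
by rewrite andbT => cz tE; have := arb_oriented tc; rewrite tE cz.
Qed.

(** Induction along a tree path from the root. If a step goes against an arc from [v] to [u] and no
    directed path reaches [v], then the root reaches [u] avoiding [v], and by [arb_away] it reaches
    [v] avoiding [u]; the edge would not be a bridge. *)
Lemma arb_connect (t : T) : connect (@arc T) (root T) t.
Proof.
have sym := delete_edge_connect_sym (arb_is_tree T).
have gen u p : connect (@arc T) (root T) u -> path (@underlying T) u p ->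
    connect (@arc T) (root T) (last u p).
  elim: p u => //= v p IH u ru /andP[uv vp]; apply: IH vp.
  case/orP: (uv) => [|vu]; first by move/connect1; apply: connect_trans.
  apply: contraT => rNv; have [q [rq _ vE uq]] := arb_away vu.
  have c1 : connect (delete_edge (@underlying T) u v) (root T) v.
    by rewrite -vE; apply: path_delete_edge.
  have c2 : connect (delete_edge (@underlying T) u v) (root T) u.
    rewrite (eq_connect (delete_edgeC _ u v)).
    case/connectP: ru => s rs ->; apply: path_delete_edge.
      by apply: sub_path rs => a b ab; rewrite /underlying /= ab.
    apply: contra rNv => vs; case/splitPl: vs rs => s1 s2 <-; rewrite cat_path => /andP[rs1 _].
    by apply/connectP; exists s1.
  have /negP[] := bridge (arb_is_tree T) uv.
  by apply: connect_trans c2; rewrite sym.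
have [_ _ conn _] := arb_is_tree T; have /connectP[p rp ->] := conn (root T) t.
exact: gen.
Qed.

End Arborescence.

(** * Separators from decompositions *)

Lemma dtd_separators (D : digraph) (d : dtree_decomposition D) :
  balanced_separators D (dtd_width d).+1.
Proof.
move=> W; have [->|[w0 w0W]] := set_0Vmem W.
  by exists set0 => [|x _]; rewrite ?cards0 // set0I cards0.
pose S (t : dtd_tree d) := \bigcup_(s | connect (@arc (dtd_tree d)) t s) dtd_beta s.
have beta_uniq s t x : x \in @dtd_beta D d s -> x \in @dtd_beta D d t -> s = t.
  move=> xs xt; apply/eqP; apply: contraT => /dtd_disjoint dis.
  by rewrite (disjointFr dis xs) in xt.
have in_beta x : exists s, x \in @dtd_beta D d s.
  have : x \in \bigcup_t @dtd_beta D d t by rewrite dtd_cover inE.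
  by case/bigcupP=> s _ xs; exists s.
pose heavy t := #|W| < #|W :&: S t|.*2.
have heavy_root : heavy (root (dtd_tree d)).
  rewrite /heavy (_ : S _ = setT); last first.
    apply/setP=> x; rewrite inE; have [s xs] := in_beta x.
    by apply/bigcupP; exists s => //; apply: arb_connect.
  have : 0 < #|W| by apply/card_gt0P; exists w0.
  by rewrite setIT; lia.
pose m t := #|[set s | connect (@arc (dtd_tree d)) t s]|.
case: (arg_minnP m heavy_root) => t t_heavy t_min.
exists (dtd_Gamma t).
  by rewrite /dtd_width; have := @leq_bigmax _ (fun t : dtd_tree d => #|dtd_Gamma t|) t; lia.
(* Off the bag, a vertex below [t] lies below some child [c]. The set below [c] is normal for a
   guard contained in [dtd_Gamma t], so it contains the whole component. *)
have inside x : x \notin dtd_Gamma t -> x \in S t ->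
    exists2 c, arc t c & scc (dtd_Gamma t) x \subset S c.
  move=> xG /bigcupP[s /connectP[[|c p] /= tp s_last] xs].
    by case/negP: xG; rewrite -s_last in_setU xs.
  case/andP: tp => tc cp; exists c => //.
  have sG : dtd_gamma (t, c) \subset dtd_Gamma t.
    apply: subset_trans (subsetUr _ _); apply: bigcup_sup.
    by rewrite /= tc eqxx.
  apply: subset_trans (sccS _ sG) _; apply: scc_sub (dtd_normal (e := (t, c)) tc) _.
  by apply/bigcupP; exists s => //; apply/connectP; exists p.
have light c : arc t c -> #|W :&: S c|.*2 <= #|W|.
  move=> tc; rewrite leqNgt; apply/negP=> /t_min; apply/negP; rewrite -ltnNge.
  apply: proper_card; apply/properP; split.
    by apply/subsetP=> s; rewrite !inE; apply: connect_trans (connect1 tc).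
  by exists t; rewrite inE ?connect0 ?arb_acyclic.
move=> x xG; have [/(inside x xG)[c tc sub]|xNS] := boolP (x \in S t).
  apply: leq_trans (light c tc); rewrite leq_double.
  by apply: subset_leq_card; apply: setIS.
(* A component with a vertex outside [S t] misses [S t] entirely, and more than half of [W] lies in
   [S t]. *)
have dis : [disjoint W :&: S t & W :&: scc (dtd_Gamma t) x].
  rewrite -setI_eq0; apply/eqP/setP=> y; rewrite !inE -/(y \in scc _ x).
  apply/negP=> /andP[/andP[_ yS] /andP[_ yx]].
  have yx' : y \in scc (dtd_Gamma t) x by rewrite inE.
  have [c tc] := inside y (scc_notin xG yx') yS.
  rewrite (scc_eq yx') => /subsetP/(_ x (in_scc _ _)) /bigcupP[s cs xs].
  case/negP: xNS; apply/bigcupP; exists s => //.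
  exact: connect_trans (connect1 tc) cs.
have : #|(W :&: S t) :|: (W :&: scc (dtd_Gamma t) x)| <= #|W|.
  by apply: subset_leq_card; rewrite subUset !subsetIl.
have := (leq_card_setU (W :&: S t) (W :&: scc (dtd_Gamma t) x)).2.
rewrite dis => /eqP ->; move: t_heavy; rewrite /heavy; lia.
Qed.

Lemma cd_separators (D : digraph) (d : cycle_decomposition D) :
  balanced_separators D (3 * cd_width d).+1.
Proof.
set k := cd_width d; move=> W.
have [treeT cubic] := cd_cubic d; have [psi phiK psiK] := cd_bij d.
case: (pickP (fun _ : D => true)) => [v0 _|D0]; last first.
  by exists set0 => [|x]; rewrite ?cards0 //; have := D0 x.
pose X (e : cd_node d * cd_node d) :=
  [set v | val (psi v) \in branch (@cd_adj D d) e.1 e.2].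
have XE e : cd_cut e = cut (X e).
  rewrite /cd_cut; congr cut; apply/setP=> v; rewrite [RHS]inE.
  apply/imsetP/idP => [[l le ->]|vB]; first by rewrite inE in le; rewrite phiK.
  by exists (psi v); rewrite ?psiK // inE.
have /choice[Z ZP] : forall e, exists Z : {set D}, #|Z| <= k /\
    (cd_adj e.1 e.2 -> forall x y, y \in scc Z x -> (x \in X e) = (y \in X e)).
  move=> e; have [adj_e|_] := boolP (cd_adj e.1 e.2); last by exists set0; rewrite cards0.
  have : porosity (cut (X e)) <= k.
    by rewrite -XE /k /cd_width; apply: (leq_bigmax_cond (F := fun e => porosity (cd_cut e))).
  by case/separator_of_porosity=> Ze le_k Ze_P; exists Ze.
pose heavy e := cd_adj e.1 e.2 && (#|W| < #|W :&: X e|.*2).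
have [[x x_light]|no_light] := pselect (exists x, forall y, ~~ heavy (y, x)).
  (* If [x] is a leaf, its own vertex lies in no branch at [x]; it accounts for the 1 in the bound
     3k + 1. *)
  pose own := [set v | (val (psi v) == x)].
  have own1 : #|own| <= 1.
    apply/card_le1_eqP=> u v; rewrite !inE => /eqP ux /eqP vx.
    by apply: (can_inj psiK); apply: val_inj; rewrite /= ux vx.
  exists (own :|: \bigcup_(y | cd_adj x y) Z (y, x)).
    have deg : #|@cd_adj D d x| <= 3.
      by have [|/cubic->//] := boolP (is_leaf (@cd_adj D d) x); rewrite /is_leaf; lia.
    have le_sum : #|\bigcup_(y | cd_adj x y) Z (y, x)| <= \sum_(y | cd_adj x y) k.
      apply: leq_trans (_ : \sum_(y | cd_adj x y) #|Z (y, x)| <= _); last first.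
        by apply: leq_sum => y _; case: (ZP (y, x)).
      elim/big_rec2: _ => [|y n A _ le_n]; first by rewrite cards0.
      by have := (leq_card_setU (Z (y, x)) A).1; lia.
    rewrite sum_nat_const in le_sum.
    have := (leq_card_setU own (\bigcup_(y | cd_adj x y) Z (y, x))).1.
    have : #|@cd_adj D d x| * k <= 3 * k by rewrite leq_mul2r deg orbT.
    lia.
  move=> v; rewrite in_setU negb_or inE => /andP[vx vZ].
  have [y xy v_in] := branch_cover treeT vx.
  have yx : cd_adj y x by rewrite (adj_sym treeT).
  have := x_light y; rewrite /heavy /= yx -leqNgt; apply: leq_trans.
  rewrite leq_double; apply: subset_leq_card; apply: setIS.
  apply/subsetP=> u uv; have [_ /(_ yx)/(_ v u)] := ZP (y, x).
  rewrite [v \in _]inE v_in => <- //; apply: (subsetP (sccS _ _)) uv.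
  apply: subset_trans (subsetUr _ _); exact: (bigcup_sup y).
have heavyP x : exists y, heavy (y, x).
  apply: contrapT => no_y; apply: no_light; exists x => y; apply/negP=> yx.
  by apply: no_y; exists y.
have [y0 heavy0] := heavyP (val (psi v0)).
(* Take a smallest heavy branch, at [y] seen from [x], and a heavy branch at [z] seen from [y]. For
   [z] = [x] the two are complementary and cannot both hold more than half of [W]; otherwise the
   second is a proper part of the first. *)
case: (arg_minnP (fun e => #|branch (@cd_adj D d) e.1 e.2|) heavy0) => -[y x] /= yx_heavy min.
have [z zy_heavy] := heavyP y.
have /andP[/= yx yx_W] := yx_heavy; have /andP[/= zy zy_W] := zy_heavy.
have yz : cd_adj y z by rewrite (adj_sym treeT).
have [zx|zx] := eqVneq z x.
  have : #|W :&: X (y, x)| + #|W :&: X (z, y)| = #|W|.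
    rewrite -(cardsID (X (y, x)) W); congr (_ + #|pred_of_set _|); apply/setP=> v.
    rewrite zx in zy *.
    by rewrite in_setD in_setI ![_ \in X _]in_set /= (branch_compl treeT zy) in_setC andbC.
  by move: yx_W zy_W; lia.
have := min (z, y) zy_heavy; rewrite leqNgt => /negP[]; apply: proper_card.
apply/properP; split; first exact: branch_sub.
by exists y; [exact: branch_root | exact: branch_notin].
Qed.

(** * Binary trees as sets of addresses *)

(** On a cycle, a vertex of largest rank would have two distinct neighbours, both equal to its only
    parent. *)
Lemma acyclic_of_parents (T : finType) (a : rel T) (rk : T -> nat) :
    (forall x y, a x y -> rk x < rk y) ->
    (forall x y z, a x z -> a y z -> x = y) ->
  acyclic [rel x y | a x y || a y x].
Proof.
move=> a_rk a_inj c /andP[cyc uc]; rewrite ltnNge; apply/negP=> c3.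
have [x0 x0c] : exists x, x \in c by case: (c) c3 => // x s _; exists x; rewrite mem_head.
case: (arg_maxnP rk x0c) => m mc m_max.
have [i s def_s] := rot_to mc.
have := cyc; rewrite -(rot_cycle i) def_s.
have := uc; rewrite -(rot_uniq i) def_s.
have : size (rot i c) = size c by rewrite size_rot.
rewrite def_s => sz.
have up y : y \in m :: s -> a y m || a m y -> a y m.
  rewrite -def_s mem_rot => /m_max le_y /orP[//|/a_rk lt_y].
  by move: le_y; rewrite /= leqNgt lt_y.
case: s {def_s} sz up => [|x s] /=; first by move=> sz; rewrite -sz in c3.
case/lastP: s => [|s y] /=; first by move=> sz; rewrite -sz in c3.
move=> _ up /and3P[_ x_notin _]; rewrite rcons_path last_rcons => /and3P[adj_x _ adj_y].
have xm : a x m by apply: up; rewrite ?inE ?eqxx ?orbT // orbC.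
have ym : a y m by apply: up; rewrite ?inE ?mem_rcons ?mem_head ?orbT.
by move: x_notin; rewrite (a_inj x y m) // mem_rcons mem_head.
Qed.

(* Nodes of binary trees are addressed by the turns on the way from the root. *)
Definition child (p q : seq bool) : bool := prefix p q && (size q == (size p).+1).

Lemma childP p q : reflect (exists b, q = rcons p b) (child p q).
Proof.
apply: (iffP andP) => [[/prefixP[[|b [|c r]] ->]]|[b ->]].
- by rewrite cats0 => /eqP/n_Sn.
- by exists b; rewrite cats1.
- by rewrite size_cat /=; lia.
- by rewrite -cats1 prefix_prefix size_cat addn1.
Qed.

Section AddressTree.
Variable A : seq (seq bool).
Hypothesis A_root : [::] \in A.
Hypothesis A_closed : forall p b, rcons p b \in A -> p \in A.

Definition node_arc : rel (seq_sub A) := [rel s t | child (val s) (val t)].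
Definition node_adj : rel (seq_sub A) := [rel s t | node_arc s t || node_arc t s].

Lemma node_arc_size s t : node_arc s t -> size (val t) = (size (val s)).+1.
Proof. by case/andP=> _ /eqP. Qed.

Lemma node_arc_inj s t u : node_arc s u -> node_arc t u -> s = t.
Proof.
move=> /childP[b ub] /childP[c uc]; apply: val_inj => /=.
by have := rcons_inj (etrans (esym ub) uc) => -[].
Qed.

Lemma node_connect s t : connect node_arc s t = prefix (val s) (val t).
Proof.
apply/idP/idP => [/connectP[p + ->]|].
  elim: p s => [|u p IH] s /=; first by rewrite prefix_refl.
  by case/andP=> /andP[su _] /IH; apply: prefix_trans.
case/prefixP=> r; elim/last_ind: r t => [|r b IH] t tE.
  by rewrite cats0 in tE; rewrite (val_inj tE) connect0.
have rA : val s ++ r \in A by apply: (@A_closed _ b); rewrite rcons_cat -tE; apply: valP.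
pose u : seq_sub A := SeqSub rA; apply: connect_trans (IH u (erefl _)) (connect1 _).
by apply/childP; exists b; rewrite tE rcons_cat.
Qed.

Definition node_root : seq_sub A := SeqSub A_root.

Lemma node_adj_sym : symmetric node_adj.
Proof. by move=> s t; rewrite /node_adj /= orbC. Qed.

Lemma node_tree : is_tree node_adj.
Proof.
split.
- exact: node_adj_sym.
- by move=> s; apply/negP=> /orP[] /node_arc_size; lia.
- have from_root t : connect node_adj node_root t.
    have : connect node_arc node_root t by rewrite node_connect prefix0s.
    by apply: connect_sub => u v uv; apply: connect1; rewrite /node_adj /= uv.
  move=> s t; apply: connect_trans (from_root t).
  by rewrite (sym_connect_sym node_adj_sym).
- apply: (@acyclic_of_parents _ node_arc (fun s => size (val s))) => [s t /node_arc_size->//|].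
  exact: node_arc_inj.
Qed.

(** The edge to the parent [t] is the only one leaving the subtree of [s]. *)
Lemma node_branch s t : node_arc t s ->
  branch node_adj s t = [set u | prefix (val s) (val u)].
Proof.
move=> ts; have sz := node_arc_size ts; apply/setP=> u; rewrite !inE; apply/idP/idP.
  have gen v p : prefix (val s) (val v) -> path (delete_edge node_adj s t) v p ->
      prefix (val s) (val (last v p)).
    elim: p v => //= w p IH v sv /andP[/andP[vw ne] wp]; apply: IH wp.
    case/orP: vw => [/andP[+ _]|wv]; first exact: prefix_trans.
    have [vs|v_s] := eqVneq v s.
      by case/negP: ne; rewrite vs (node_arc_inj (s := w) (t := t) (u := v)) // vs.
    have /childP[b vb] := wv; case/prefixP: sv => r; rewrite vb.
    case/lastP: r => [|r c]; last by rewrite -rcons_cat => /rcons_inj[->]; rewrite prefix_prefix.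
    by rewrite cats0 -vb => /val_inj v_eq; rewrite v_eq eqxx in v_s.
  by case/connectP=> p sp ->; apply: gen sp; apply: prefix_refl.
rewrite -node_connect => /connectP[p sp ->].
rewrite (eq_connect (delete_edgeC node_adj s t)); apply: path_delete_edge.
  by apply: sub_path sp => v w vw; rewrite /node_adj /= vw.
apply/negP=> t_in; have : connect node_arc s t.
  by case/splitPl: t_in sp => p1 p2 <-; rewrite cat_path => /andP[h _]; apply/connectP; exists p1.
by rewrite node_connect => /size_prefix; rewrite sz ltnn.
Qed.

Definition node_digraph : digraph := @Digraph (seq_sub A) node_arc.

Lemma node_oriented (u v : node_digraph) : arc u v -> ~~ arc v u.
Proof. by move=> /node_arc_size uv; apply/negP=> /node_arc_size; rewrite uv; lia. Qed.

Lemma node_away (u v : node_digraph) : arc u v -> points_away (node_root : node_digraph) u v.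
Proof.
move=> uv; have : connect node_arc node_root u by rewrite node_connect prefix0s.
case/connectP=> p rp uE; exists p.
have trans : transitive (fun s t : seq_sub A => size (val s) < size (val t)).
  by move=> s t w; apply: ltn_trans.
have lt_p : path (fun s t : seq_sub A => size (val s) < size (val t)) node_root p.
  by apply: sub_path rp => s t /node_arc_size->.
split=> //.
- by apply: sub_path rp => s t st; rewrite /underlying /=; apply/orP; left.
- by apply: (sorted_uniq trans) => // s; rewrite ltnn.
- apply/negP=> v_in; have : connect node_arc v u.
    by case/splitPl: v_in rp uE => p1 p2 <-; rewrite cat_path last_cat => /andP[_ h] ->;
       apply/connectP; exists p2.
  by rewrite node_connect => /size_prefix; have := node_arc_size uv => /= ->; rewrite ltnn.
Qed.

Definition node_arborescence : arborescence :=
  @Arborescence node_digraph node_root node_tree node_oriented node_away.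

End AddressTree.

Definition graft_nodes (A : bool -> seq (seq bool)) : seq (seq bool) :=
  [::] :: map (cons true) (A true) ++ map (cons false) (A false).

Definition graft (X : Type) (x : X) (f : bool -> seq bool -> X) (p : seq bool) : X :=
  if p is b :: q then f b q else x.

Lemma mem_graft_nodes A b q : (b :: q \in graft_nodes A) = (q \in A b).
Proof.
have inj c : injective (cons c : seq bool -> seq bool) by move=> u v [].
rewrite inE /= mem_cat; case: b.
- rewrite (mem_map (inj true)) [X in _ || X](_ : _ = false) ?orbF //.
  by apply/mapP=> -[].
- rewrite (mem_map (inj false)) [X in X || _](_ : _ = false) //.
  by apply/mapP=> -[].
Qed.

Lemma graft_nodes_closed A : (forall b p c, rcons p c \in A b -> p \in A b) ->
  forall p c, rcons p c \in graft_nodes A -> p \in graft_nodes A.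
Proof.
by move=> A_closed [|b p] c //; rewrite rcons_cons !mem_graft_nodes; apply: A_closed.
Qed.

(** * Directed tree decompositions from splittings *)

Section DirectedTreeDecomposition.
Variable D : digraph.

Definition bags_below (A : seq (seq bool)) (beta : seq bool -> {set D}) p : {set D} :=
  [set v | has (fun q => prefix p q && (v \in beta q)) A].

Lemma bags_belowP (A : seq (seq bool)) (beta : seq bool -> {set D}) p v :
  reflect (exists q, [/\ q \in A, prefix p q & v \in beta q]) (v \in bags_below A beta p).
Proof.
rewrite inE; apply: (iffP hasP) => [[q qA /andP[pq vq]]|[q [qA pq vq]]]; exists q => //.
by rewrite pq.
Qed.

(** Here [gamma p] guards the arc into [p]. The root has a guard too, which becomes that of an arc
    once the tree is grafted under a new root. *)
Record guarded_tree K (g S : {set D}) (A : seq (seq bool))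
    (beta gamma : seq bool -> {set D}) : Prop := GuardedTree {
  gt_root : [::] \in A;
  gt_closed : forall p b, rcons p b \in A -> p \in A;
  gt_guard : gamma [::] = g;
  gt_disjoint : forall p q v, p \in A -> q \in A -> v \in beta p -> v \in beta q -> p = q;
  gt_cover : bags_below A beta [::] = S;
  gt_normal : forall p, p \in A -> normal (gamma p) (bags_below A beta p);
  gt_width : forall p, p \in A -> exists2 Z : {set D}, #|Z| <= K &
    [/\ beta p \subset Z, gamma p \subset Z & forall b, gamma (rcons p b) \subset Z] }.

Lemma normal0 (Z : {set D}) : normal Z set0.
Proof. by apply/normalE; split=> [|x y z]; rewrite ?disjoints_subset ?sub0set ?inE. Qed.

Lemma guarded_treeP K (g S : {set D}) : guarded K g S ->
  exists A beta gamma, guarded_tree K g S A beta gamma.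
Proof.
elim=> {g S} [g le_g|g S g1 S1 g2 S2 Z nrmS le_Z [sB sg sg1 sg2] [sS1 sS2 dis] _
    [A1 [beta1 [gamma1 T1]]] _ [A2 [beta2 [gamma2 T2]]]].
  have below0 p : bags_below [:: [::]] (fun _ => set0) p = set0.
    by apply/setP=> v; rewrite !inE /= ?inE ?andbF.
  exists [:: [::]], (fun _ => set0), (fun _ => g); split=> //.
  - by move=> [|? ?].
  - by move=> p q v _ _; rewrite inE.
  - by move=> p _; rewrite below0; apply: normal0.
  - by move=> p _; exists g => //; split; rewrite ?sub0set.
pose A b := if b then A1 else A2; pose S' b := if b then S1 else S2.
pose beta b := if b then beta1 else beta2; pose gamma b := if b then gamma1 else gamma2.
pose g' b := if b then g1 else g2.
have T b : guarded_tree K (g' b) (S' b) (A b) (beta b) (gamma b) by case: b.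
have sg' b : g' b \subset Z by case: b.
have belowS b q v : v \in bags_below (graft_nodes A) (graft (S :\: (S1 :|: S2)) beta) (b :: q) =
    (v \in bags_below (A b) (beta b) q).
  apply/bags_belowP/bags_belowP=> [[[|c r]]|[r [rA qr vr]]].
  - by case.
  - case=> + /= /andP[/eqP bc qr] vr; rewrite mem_graft_nodes -bc => rA.
    by exists r; split; rewrite // bc.
  - by exists (b :: r); rewrite mem_graft_nodes rA /= eqxx qr.
have below0 : bags_below (graft_nodes A) (graft (S :\: (S1 :|: S2)) beta) [::] = S.
  apply/setP=> v; apply/bags_belowP/idP=> [[[|b q]]|vS].
  - by case=> _ _ /=; rewrite !inE => /andP[].
  - case=> + _ /= vq; rewrite mem_graft_nodes => qA.
    have : v \in S' b by rewrite -(gt_cover (T b)); apply/bags_belowP; exists q; rewrite prefix0s.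
    by case: b {qA vq} => /=; apply: subsetP.
  - have [v12|v12] := boolP (v \in S1 :|: S2); last first.
      by exists [::]; rewrite /= !inE -in_setU v12 vS.
    have [b] : exists b, v \in S' b.
      by move: v12; rewrite inE => /orP[]; [exists true | exists false].
    rewrite -(gt_cover (T b)) => /bags_belowP[q [qA _ vq]].
    by exists (b :: q); rewrite mem_graft_nodes.
have inS' b q v : q \in A b -> v \in beta b q -> v \in S' b.
  by move=> qA vq; rewrite -(gt_cover (T b)); apply/bags_belowP; exists q; rewrite prefix0s.
have S'12 b v : v \in S' b -> v \in S1 :|: S2 by rewrite inE; case: b => ->; rewrite ?orbT.
exists (graft_nodes A), (graft (S :\: (S1 :|: S2)) beta), (graft g gamma); split=> //.
- by apply: graft_nodes_closed => b; apply: gt_closed (T b).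
- move=> [|b p] [|c q] v //=; rewrite ?mem_graft_nodes.
  + by move=> _ qA; rewrite in_setD => /andP[/negP + _] /(inS' _ _ _ qA)/S'12.
  + by move=> pA _ /(inS' _ _ _ pA)/S'12 v12; rewrite in_setD v12.
  move=> pA qA vp vq; have vb := inS' _ _ _ pA vp; have vc := inS' _ _ _ qA vq.
  have bc : b = c.
    by case: b c vb vc {pA qA vp vq} => -[] //= v1 v2;
      have := disjointFr dis; [move/(_ v v1)|move/(_ v v2)]; rewrite ?v1 ?v2.
  by subst c; rewrite (gt_disjoint (T b) pA qA vp vq).
- move=> [|b p] pA; first by rewrite below0.
  rewrite mem_graft_nodes in pA; rewrite (_ : bags_below _ _ _ = bags_below (A b) (beta b) p).
    exact: gt_normal (T b) _ pA.
  by apply/setP=> v; apply: belowS.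
- move=> [_|b p]; last by rewrite mem_graft_nodes; apply: gt_width (T b) p.
  exists Z => //; split=> // b /=; rewrite (gt_guard (T b)); exact: sg'.
Qed.

Lemma dtw_guarded K : guarded K set0 [set: D] -> dtw D <= K.
Proof.
case/guarded_treeP=> A [beta [gamma T]].
pose G := node_arborescence (gt_root T) (gt_closed T).
pose bag (s : G) : {set D} := beta (val (s : seq_sub A)).
pose guard (e : G * G) : {set D} := gamma (val (e.2 : seq_sub A)).
have bag_disjoint s t : s != t -> [disjoint bag s & bag t].
  move=> st; rewrite -setI_eq0; apply/eqP/setP=> v; rewrite !inE; apply/negP=> /andP[vs vt].
  by case/eqP: st; apply: val_inj; apply: (gt_disjoint T _ _ vs vt); apply: valP.
have belowE (P : pred G) p : (forall t, P t = prefix p (val (t : seq_sub A))) ->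
    \bigcup_(t | P t) bag t = bags_below A beta p.
  move=> PE; apply/setP=> v; apply/bigcupP/bags_belowP=> [[t]|[q [qA pq vq]]].
    by rewrite PE => pt vt; exists (val (t : seq_sub A)); split=> //; apply: valP.
  by exists (SeqSub qA : seq_sub A); rewrite ?PE.
have cover : \bigcup_t bag t = [set: D].
  by rewrite (belowE _ [::]) ?(gt_cover T) // => t; rewrite prefix0s.
have normal_guard (e : G * G) : arc e.1 e.2 ->
    normal (guard e) (\bigcup_(t | below e t) bag t).
  move=> _; rewrite (belowE _ (val (e.2 : seq_sub A))); first exact: (gt_normal T) (valP _).
  by move=> t; apply: node_connect (gt_closed T) _ _.
pose d := @DtreeDecomposition D G bag guard bag_disjoint cover normal_guard.
have le_width : dtd_width d <= K.
  rewrite /dtd_width; suff : \max_(t : dtd_tree d) #|dtd_Gamma t| <= K by lia.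
  apply/bigmax_leqP=> t _; have [Z le_Z [sbeta sgamma schild]] := gt_width T (valP (t : seq_sub A)).
  apply: leq_trans le_Z; apply: subset_leq_card; rewrite subUset sbeta /=.
  apply/bigcupsP=> -[u v] /andP[/= uv /orP[/eqP ut|/eqP vt]]; rewrite /guard /=.
    have uv' : child (val (u : seq_sub A)) (val (v : seq_sub A)) by [].
    by have [b ->] := childP _ _ uv'; rewrite ut.
  by rewrite vt.
rewrite /dtw; case: ex_minnP => n _ n_min; apply: leq_trans le_width.
by apply: n_min; apply/asboolP; exists d.
Qed.

End DirectedTreeDecomposition.

(** * Cycle decompositions from splittings *)

Lemma cutC (D : digraph) (X : {set D}) : cut (~: X) = cut X.
Proof. by apply/setP=> a; rewrite !inE; case: (_ \in X); case: (_ \in X). Qed.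

Section CycleDecomposition.
Variable D : digraph.
Implicit Types (X : {set D}) (A : seq (seq bool)) (f : seq bool -> D).

(** These are the rooted binary trees with vertices of D at the leaves and a cut of small porosity
    at each node; the sets built are never empty. *)
Inductive splittable N : {set D} -> Prop :=
| splittable1 (x : D) of porosity (cut [set x]) <= N : splittable N [set x]
| splittableU X1 X2 of splittable N X1 & splittable N X2 & [disjoint X1 & X2] &
    porosity (cut (X1 :|: X2)) <= N : splittable N (X1 :|: X2).

(** Children come in pairs by [ct_binary], so testing a single turn is enough. *)
Definition address_leaf A p : bool := (p \in A) && (rcons p true \notin A).

Definition leaves_below A f p : {set D} :=
  [set v | has (fun q => [&& address_leaf A q, prefix p q & f q == v]) A].

Lemma leaves_belowP A f p v :
  reflect (exists q, [/\ address_leaf A q, prefix p q & f q = v]) (v \in leaves_below A f p).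
Proof.
rewrite inE; apply: (iffP hasP) => [[q qA /and3P[ql pq /eqP vq]]|[q [ql pq vq]]]; exists q => //.
  by case/andP: ql.
by rewrite ql pq vq eqxx.
Qed.

Record cut_tree N X A f : Prop := CutTree {
  ct_root : [::] \in A;
  ct_closed : forall p b, rcons p b \in A -> p \in A;
  ct_binary : forall p b c, rcons p b \in A -> rcons p c \in A;
  ct_inj : forall p q, address_leaf A p -> address_leaf A q -> f p = f q -> p = q;
  ct_cover : leaves_below A f [::] = X;
  ct_porosity : forall p, p \in A -> porosity (cut (leaves_below A f p)) <= N }.

Lemma address_leaf_graft (A : bool -> seq (seq bool)) b q :
  address_leaf (graft_nodes A) (b :: q) = address_leaf (A b) q.
Proof. by rewrite /address_leaf rcons_cons !mem_graft_nodes. Qed.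

Lemma leaves_below_graft (A : bool -> seq (seq bool)) x (f : bool -> seq bool -> D) b q :
  leaves_below (graft_nodes A) (graft x f) (b :: q) = leaves_below (A b) (f b) q.
Proof.
apply/setP=> v; apply/leaves_belowP/leaves_belowP=> [[[|c r]]|[r [rA qr vr]]].
- by case.
- case=> + /= /andP[/eqP bc qr] vr; rewrite address_leaf_graft -bc => rA.
  by exists r; split; rewrite // bc.
- by exists (b :: r); rewrite address_leaf_graft rA /= eqxx qr.
Qed.

Lemma cut_treeP N X : splittable N X -> exists A f, cut_tree N X A f.
Proof.
elim=> {X} [x por_x|X1 X2 _ [A1 [f1 T1]] _ [A2 [f2 T2]] dis por_X].
  have below p : leaves_below [:: [::]] (fun _ => x) p = if p is [::] then [set x] else set0.
    apply/setP=> v; apply/leaves_belowP/idP=> [[[|b q] []]|] //.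
      by case: p => //= _ _ ->; rewrite inE.
    by case: p => [|b p]; rewrite inE // => /eqP->; exists [::].
  exists [:: [::]], (fun _ => x); split=> //; try by move=> [|? ?].
  - by move=> [|? ?] [|? ?].
  - by rewrite below.
  - by move=> [|? ?]; rewrite ?below.
pose A b := if b then A1 else A2; pose f b := if b then f1 else f2.
pose X b := if b then X1 else X2.
have T b : cut_tree N (X b) (A b) (f b) by case: b.
(* The new root is not a leaf and [leaves_below] ignores its label, so any vertex serves as
   default. *)
pose x0 := f1 [::].
have XU b v : v \in X b -> v \in X1 :|: X2 by rewrite inE; case: b => ->; rewrite ?orbT.
have below0 : leaves_below (graft_nodes A) (graft x0 f) [::] = X1 :|: X2.
  apply/setP=> v; apply/leaves_belowP/idP=> [[[|b q]]|v12].
  - by case; rewrite /address_leaf -[rcons _ _]/[:: true] mem_graft_nodes (ct_root (T true)) andbF.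
  - case=> + _ /= vq; rewrite address_leaf_graft => qA.
    by apply: (XU b); rewrite -(ct_cover (T b)); apply/leaves_belowP; exists q; rewrite prefix0s.
  - have [b] : exists b, v \in X b.
      by move: v12; rewrite inE => /orP[]; [exists true | exists false].
    rewrite -(ct_cover (T b)) => /leaves_belowP[q [qA _ vq]].
    by exists (b :: q); rewrite address_leaf_graft.
have inX b q : address_leaf (A b) q -> f b q \in X b.
  by move=> qA; rewrite -(ct_cover (T b)); apply/leaves_belowP; exists q; rewrite prefix0s.
have leafN : address_leaf (graft_nodes A) [::] = false.
  by rewrite /address_leaf -[rcons _ _]/[:: true] mem_graft_nodes (ct_root (T true)) andbF.
exists (graft_nodes A), (graft x0 f); split=> //.
- by apply: graft_nodes_closed => b; apply: ct_closed (T b).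
- move=> [|b' p] b c; first by rewrite !mem_graft_nodes (ct_root (T c)).
  by rewrite !rcons_cons !mem_graft_nodes; apply: ct_binary (T b') p b c.
- move=> [|b p] [|c q]; rewrite ?leafN // !address_leaf_graft /= => pA qA eq_v.
  have vb := inX _ _ pA; have vc := inX _ _ qA; rewrite -eq_v in vc.
  have bc : b = c.
    move: vb vc; move: (f b p) => v; have := disjointFr dis (x := v).
    by case: b c {pA qA eq_v} => -[] //= dv v1 v2; [rewrite dv in v2 | rewrite dv in v1].
  by subst c; rewrite (ct_inj (T b) pA qA eq_v).
- move=> [|b p]; first by rewrite below0.
  by rewrite mem_graft_nodes leaves_below_graft; apply: ct_porosity (T b) p.
Qed.

(* The remaining vertex v0 becomes a leaf attached above the root of the tree,
   which gives the root its third neighbour. *)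
Lemma cycw_splittable N v0 : splittable N [set~ v0] -> cycw D <= N.
Proof.
case/cut_treeP=> A1 [f1 T].
(* The new root carries [v0] and has the old tree as its only subtree, so it is a leaf of the
   unrooted tree. *)
pose B b := if b then A1 else [::]; pose f (b : bool) := f1.
pose A := graft_nodes B; pose phi0 := graft v0 f.
have Aroot : [::] \in A by [].
have Aclosed p b : rcons p b \in A -> p \in A.
  by apply: graft_nodes_closed => -[]; [apply: ct_closed T|].
have Atrue : [:: true] \in A by rewrite mem_graft_nodes (ct_root T).
have Abinary p b c : p != [::] -> rcons p b \in A -> rcons p c \in A.
  case: p => [//|[] p] _; rewrite !rcons_cons !mem_graft_nodes //=; exact: ct_binary T _ _ _.
have Afalse q : false :: q \notin A by rewrite mem_graft_nodes.
pose adj := @node_adj A.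
have treeT : is_tree adj := node_tree Aroot Aclosed.
pose T' := seq_sub A.
have adjP (s t : T') : (t \in adj s) = child (val s) (val t) || child (val t) (val s) by [].
have deg_root (s : T') : val s = [::] -> #|adj s| = 1.
  move=> s0; rewrite -(card1 (SeqSub Atrue : T')); apply: eq_card => t; rewrite adjP s0 [RHS]inE.
  apply/idP/eqP => [|->//]; case/orP=> /childP[b tE]; last by case: (val t) tE.
  apply: val_inj; rewrite /= tE; case: b tE => //= tE.
  by have := valP t; rewrite /= tE (negPf (Afalse _)).
have deg_leaf (s : T') : val s != [::] -> rcons (val s) true \notin A -> #|adj s| = 1.
  move=> s0 sA; case/lastP sE : (val s) s0 => [//|p b] _.
  have pA : p \in A by apply: (Aclosed p b); rewrite -sE; apply: valP.
  rewrite -(card1 (SeqSub pA : T')); apply: eq_card => t; rewrite adjP [RHS]inE.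
  apply/idP/eqP => [|->]; last by rewrite sE; apply/orP; right; apply/childP; exists b.
  case/orP=> /childP[c tE].
    by case/negP: sA; apply: (Abinary _ c); rewrite -?tE ?sE; [case: (p) | apply: valP].
  by apply: val_inj; move: tE; rewrite sE => /rcons_inj[].
have deg_inner (s : T') : val s != [::] -> rcons (val s) true \in A -> #|adj s| = 3.
  move=> s0 sA; have sA' : rcons (val s) false \in A by apply: Abinary sA.
  case/lastP sE : (val s) s0 => [//|p b] _.
  have pA : p \in A by apply: (Aclosed p b); rewrite -sE; apply: valP.
  pose l : seq T' := [:: SeqSub pA; SeqSub sA; SeqSub sA'].
  have ul : uniq l.
    rewrite /= !inE -!val_eqE /= eqseq_rcons eqxx /= andbT negb_or.
    by apply/andP; split; apply/eqP=> /(congr1 size); rewrite !size_rcons sE size_rcons; lia.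
  rewrite -[RHS]/(size l) -(card_uniqP ul); apply: eq_card => t; rewrite adjP.
  rewrite !inE -!val_eqE /=; apply/idP/idP.
    case/orP=> /childP[c tE]; first by rewrite tE; case: c tE => _; rewrite eqxx ?orbT.
    by move: tE; rewrite sE => /rcons_inj[-> _]; rewrite eqxx.
  case/or3P=> /eqP->; apply/orP; [right|left|left]; apply/childP.
  - by exists b.
  - by exists true.
  - by exists false.
have leafE (s : T') : is_leaf adj s = (val s == [::]) || (rcons (val s) true \notin A).
  rewrite /is_leaf; have [s0|s0] := eqVneq (val s) [::]; first by rewrite deg_root.
  by have [sA|sA] := boolP (_ \in A); [rewrite deg_inner | rewrite deg_leaf].
have cubic : is_cubic_tree adj.
  split=> // s; rewrite leafE negb_or negbK => /andP[]; exact: deg_inner.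
pose phi (l : {t : T' | is_leaf adj t}) : D := phi0 (val (val l)).
have leaf1 (s : T') b q : val s = b :: q -> is_leaf adj s -> b = true /\ address_leaf A1 q.
  move=> sE; have := valP s; rewrite leafE sE /= !mem_graft_nodes; case: b {sE} => //= qA.
  by rewrite /address_leaf qA.
have in1 q : address_leaf A1 q -> f1 q != v0.
  move=> ql; rewrite -in_setC1 -(ct_cover T); apply/leaves_belowP; exists q.
  by rewrite prefix0s.
have phi_inj : injective phi.
  move=> s t; rewrite /phi => eq_st; apply: val_inj; apply: val_inj => /=.
  have := leaf1 (val s); have := leaf1 (val t); move: (valP s) (valP t) eq_st => /=.
  case: (ssval (val s)) => [|b p]; case: (ssval (val t)) => [|c q] //= sl tl.
  - by move=> eq_v /(_ _ _ erefl tl)[_ ql]; have := in1 q ql; rewrite [f1 q](esym eq_v) eqxx.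
  - by move=> eq_v _ /(_ _ _ erefl sl)[_ pl]; have := in1 p pl; rewrite [f1 p]eq_v eqxx.
  - by move=> eq_v /(_ _ _ erefl tl)[-> ql] /(_ _ _ erefl sl)[-> pl]; rewrite (ct_inj T pl ql eq_v).
have leaf2 q : address_leaf A1 q -> exists2 l, phi l = f1 q & val (val l) = true :: q.
  move=> /andP[qA qN]; have qA' : true :: q \in A by rewrite mem_graft_nodes.
  have ql : is_leaf adj (SeqSub qA' : T') by rewrite leafE /= mem_graft_nodes.
  by exists (Sub _ ql).
have phi_surj v : exists l, phi l = v.
  have [->|v_neq] := eqVneq v v0.
    have rl : is_leaf adj (SeqSub Aroot : T') by rewrite leafE.
    by exists (Sub _ rl).
  have : v \in leaves_below A1 f1 [::] by rewrite (ct_cover T) !inE.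
  by case/leaves_belowP=> q [/leaf2[l lE _] _ <-]; exists l.
have phi_bij : bijective phi.
  have [psi psiK] := choice phi_surj; exists psi => // l.
  by apply: phi_inj; rewrite psiK.
pose d := @CycleDecomposition D T' adj phi cubic phi_bij.
have cut_below (s t : T') : node_arc t s ->
    porosity (cut [set phi l | l : {t | is_leaf adj t}
      & val l \in [set u : T' | prefix (val s) (val u)]]) <= N.
  case/childP=> b sE; case sq : (val s) => [|c q].
    by move: sE; rewrite sq; case: (val t).
  have := valP s; rewrite /= -[ssval s]/(val s) sq.
  case: c sq => sq; last by rewrite (negPf (Afalse q)).
  rewrite mem_graft_nodes => qA; rewrite (_ : [set _ | _ in _] = leaves_below A1 f1 q).
    exact: ct_porosity T q qA.
  apply/setP=> v; apply/imsetP/leaves_belowP=> [[l]|[r [rl qr <-]]].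
    rewrite !inE; case lE : (val (val l)) => [//|c r] /= /andP[_ qr] ->.
    have [_ rl] := leaf1 _ _ _ lE (valP l).
    by exists r; split=> //; rewrite /phi lE.
  by have [l <- lE] := leaf2 r rl; exists l; rewrite ?inE ?lE.
have le_width : cd_width d <= N.
  apply/bigmax_leqP=> -[s t] /= st; rewrite /cd_cut.
  have [ts|nts] := boolP (node_arc t s).
    have -> : cd_component (d := d) (s, t) = [set u : T' | prefix (val s) (val u)].
      exact: node_branch ts.
    exact: cut_below ts.
  have ts : node_arc s t by move: st; rewrite /adj /node_adj /= (negPf nts) orbF.
  (* Seen from the parent, the component is the complement of a subtree and has the same cut. *)
  have -> : cd_component (d := d) (s, t) = ~: [set u : T' | prefix (val t) (val u)].
    by rewrite -(node_branch Aclosed ts); apply: branch_compl treeT _ _ st.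
  rewrite -cutC (_ : ~: _ = [set phi l | l : {t | is_leaf adj t}
    & val l \in [set u : T' | prefix (val t) (val u)]]); first exact: cut_below ts.
  apply/setP=> v; have [l <-] := phi_surj v.
  have mem_phi (U : {set T'}) :
      (phi l \in [set phi l | l : {t | is_leaf adj t} & val l \in U]) = (val l \in U).
    by rewrite mem_imset // inE.
  by rewrite in_setC !mem_phi in_setC negbK.
rewrite /cycw; case: ex_minnP => n _ n_min; apply: leq_trans le_width.
by apply: n_min; apply/asboolP; exists d.
Qed.

End CycleDecomposition.

(* Every intermediate set differs from a guarded one only inside a set Z of
   bounded size, so the vertices of a bag can be added one at a time. *)
Lemma guarded_splittable (D : digraph) K (g S : {set D}) (v0 : D) : guarded K g S ->
  S :\ v0 = set0 \/ splittable (6 * K.+1) (S :\ v0).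
Proof.
elim=> {g S} [g _|g S g1 S1 g2 S2 Z nrmS le_Z [sB sg sg1 sg2] [sS1 sS2 dis] _ IH1 _ IH2].
  by left; rewrite set0D.
(* All sets formed at this node agree with [S] outside [v0 |: Z], which has at most K + 1
   vertices. *)
have por X : X :\: (v0 |: Z) = S :\: (v0 |: Z) -> porosity (cut X) <= 6 * K.+1.
  move=> eqX; apply: leq_trans (porosity_normal nrmS _ eqX) _.
    by apply: subset_trans sg (subsetUr _ _).
  by have := cardsU1 v0 Z; lia.
pose W := (S1 :|: S2) :\ v0.
have splitW : W = set0 \/ splittable (6 * K.+1) W.
  rewrite /W setDUl; case: IH1 => [->|h1]; first by rewrite set0U.
  case: IH2 => [->|h2]; first by rewrite setU0; right.
  right; apply: splittableU => //.
    rewrite disjoint_subset; apply/subsetP=> x.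
    by rewrite !inE => /andP[_ /(disjointFr dis)->]; rewrite andbF.
  apply: por; apply/setP=> x; have /subsetP/(_ x)/implyP := sB.
  have /implyP := subsetP sS1 x; have /implyP := subsetP sS2 x; rewrite !inE.
  by case: (x == v0); case: (x \in Z); case: (x \in S); case: (x \in S1); case: (x \in S2).
have step : forall B : {set D}, B \subset (S :\ v0) :\: W ->
    W :|: B = set0 \/ splittable (6 * K.+1) (W :|: B).
  move=> B; have [n] := ubnP #|B|; elim: n B => // n IHn B /ltnSE le_n sBW.
  have [->|[x xB]] := set_0Vmem B; first by rewrite setU0.
  have := subsetP sBW x xB; rewrite in_setD in_setD1 => /andP[xW /andP[x0 xS]].
  have por_x : porosity (cut [set x]) <= 6 * K.+1.
    have nrm0 : normal (set0 : {set D}) set0 by apply: normal0.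
    apply: leq_trans (porosity_normal (Z' := [set x]) (S' := [set x]) nrm0 _ _) _.
    - exact: sub0set.
    - by rewrite setDv set0D.
    - by rewrite cards1; lia.
  have Bx : W :|: B = (W :|: B :\ x) :|: [set x].
    by rewrite -setUA [_ :|: [set x]]setUC setD1K.
  right; have [||W0|splitB] := IHn (B :\ x).
  - by move: le_n; rewrite (cardsD1 x B) xB.
  - exact: subset_trans (subsetDl _ _) sBW.
  - by rewrite Bx W0 set0U; apply: splittable1.
  rewrite Bx; apply: splittableU => //.
  - exact: splittable1.
  - by rewrite disjoint_sym disjoints1 in_setU in_setD1 eqxx orbF.
  rewrite -Bx; apply: por; apply/setP=> y; have /subsetP/(_ y)/implyP := sB.
  have /implyP := subsetP sBW y; have /implyP := subsetP sS1 y.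
  have /implyP := subsetP sS2 y; rewrite !inE.
  by case: (y == v0); case: (y \in Z); case: (y \in S); case: (y \in S1); case: (y \in S2);
    case: (y \in B).
have := step _ (subxx _); rewrite setDE setUIr setUCr setIT.
by rewrite (setUidPr _) //; apply: setSD; rewrite subUset sS1.
Qed.

Lemma cycw_guarded (D : digraph) K : guarded K set0 [set: D] -> cycw D <= 6 * K.+1.
Proof.
(* With at most one vertex, nothing remains to split after removing [v0]; then every cut has
   porosity at most 6, by taking all vertices as the exceptional set. *)
move=> guardD; have [le1|gt1] := leqP #|D| 1.
  have [d] := cd_exists D; rewrite /cycw; case: ex_minnP => n _ n_min.
  apply: (@leq_trans (cd_width d)); first by apply: n_min; apply/asboolP; exists d.
  apply/bigmax_leqP=> e _; have nrm0 : normal (set0 : {set D}) set0 by apply: normal0.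
  apply: leq_trans (porosity_normal (Z' := setT) nrm0 (sub0set _) _) _.
    by rewrite !setDT.
  by rewrite cardsT; lia.
have /card_gt0P[v0 _] : 0 < #|D| by lia.
case: (guarded_splittable v0 guardD) => [|splitD].
  rewrite setTD => /(congr1 (fun X : {set D} => #|X|)); rewrite cardsC1 cards0; lia.
by apply: (cycw_splittable (v0 := v0)); rewrite setTD in splitD.
Qed.

Theorem theorem3p15 (C : digraph -> Prop) :
  bounded_on C dtw <-> bounded_on C cycw.
Proof.
split=> -[k le_k].
(* Separators of size w = k + 1 give a guarded splitting of width 3(w + 1) = 3(k + 2). *)
- exists (6 * (3 * k.+2).+1) => D /le_k; rewrite /dtw; case: ex_minnP => n /asboolP[d <-] _ le_d.
  apply: cycw_guarded; apply: guarded_all => W.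
  have [Z le_Z Z_bal] := dtd_separators d W; exists Z => //; lia.
(* Here w = 3k + 1, and the splitting has width 3(w + 1) = 3(3k + 2). *)
- exists (3 * (3 * k).+2) => D /le_k; rewrite /cycw; case: ex_minnP => n /asboolP[d <-] _ le_d.
  apply: dtw_guarded; apply: guarded_all => W.
  have [Z le_Z Z_bal] := cd_separators d W; exists Z => //; lia.
Qed.
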